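(* Let $\mathcal{C}_1$ and $\mathcal{C}_2$ be two unitary modular tensor categories with the same underlying strict unitary fusion category structure, i.e. $\mathcal{C}_1=(\mathcal{C},\times,\mathrm{id},\varepsilon)$ and $\mathcal{C}_2=(\mathcal{C},\times,\mathrm{id},\widetilde\varepsilon)$, where $\times$ and $\mathrm{id}$ denote respectively the tensor multiplication and the tensor unit, and $\varepsilon$, $\widetilde\varepsilon$ are the respective braidings. Assume that $\mathcal{C}_1$ and $\mathcal{C}_2$ have the same modular data. Then $\mathcal{C}$ can be equipped with another (equivalent, but non-strict) unitary fusion category structure $(\mathcal{C},\times,\alpha,\mathrm{id})$ having tensor multiplication $\times$ and associator $\alpha$, where the equivalence is of the form $(\mathrm{Id},U,1):(\mathcal{C},\times,\mathrm{id})\to(\mathcal{C},\times,\alpha,\mathrm{id})$. Moreover, $\widetilde\varepsilon$ is a braiding on $(\mathcal{C},\times,\alpha,\mathrm{id})$, and $(\mathrm{Id},U,1):(\mathcal{C},\times,\mathrm{id},\varepsilon)\to(\mathcal{C},\times,\alpha,\mathrm{id},\widetilde\varepsilon)$ is a unitary braided tensor equivalence.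
   Context: A unitary modular tensor category (UMTC) is a unitary fusion category (UFTC: a $C^*$-tensor category with finite-dimensional Hom spaces, finite direct sums, subobjects, conjugates, finitely many isomorphism classes of irreducible objects, irreducible tensor unit $\mathrm{id}$, and unitary associator), equipped with a unitary braiding $\varepsilon_{a,b}\in\mathrm{Hom}_{\mathcal{C}}(a\times b,b\times a)$ which is modular, i.e. the matrix $S$ below is invertible. The structure is strict when the associator is the identity. The tensor product is written $\times$, the adjoint of a morphism $t$ is $t^*$, and $\overline a$ denotes a conjugate (dual) of $a$. Modular data $\{n,\Delta,N,S,T\}$: $n+1$ is the rank; $\Delta$ is the set of unitary isomorphism classes of irreducible objects, labelled by $0,\dots,n$, with $0$ the class of $\mathrm{id}$; with $a_i$ a representative of class $i$, $N^k_{i,j}=\dim\mathrm{Hom}_{\mathcal{C}}(a_k,a_i\times a_j)$. Let $d_i>0$ be the intrinsic (quantum) dimension of $a_i$. If $r\in\mathrm{Hom}_{\mathcal C}(\mathrm{id},\overline{a_i}\times a_i)$ is part of a standard solution of the conjugate equations (so $r^*\circ r=d_i$), the phase $\omega_i$ is defined by $(r^*\times1_{a_i})\circ(1_{\overline{a_i}}\times\varepsilon_{a_i,a_i})\circ(r\times1_{a_i})=\omega_i1_{a_i}$. Put $Y_{i,j}=\sum_kN^k_{i,j}\frac{\omega_i\omega_j}{\omega_k}d_k$, $\sigma=\sum_id_i^2\omega_i^{-1}$, $S_{i,j}=|\sigma|^{-1}Y_{i,j}$, $T_{i,j}=(\sigma/|\sigma|)^{1/3}\omega_i\delta_{i,j}$.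 That $\mathcal{C}_1$ and $\mathcal{C}_2$ have the same modular data means that these data, computed from $\varepsilon$ and from $\widetilde\varepsilon$ on the same spectrum, coincide. Tensor equivalences of the form $(\mathrm{Id},U,1)$: the underlying functor is the identity functor of $\mathcal{C}$, the unit constraint is the identity, and $U=\{U_{a,b}\in\mathrm{Hom}_{\mathcal{C}}(a\times b,a\times b)\}$ is a family of unitaries natural in $a,b$. It is a unitary tensor equivalence $(\mathcal{C},\times,\mathrm{id})\to(\mathcal{C},\times,\alpha,\mathrm{id})$ when it is compatible with the units and $$U_{a,b\times c}\circ(1_a\times U_{b,c})\circ\alpha_{a,b,c}=U_{a\times b,c}\circ(U_{a,b}\times1_c)$$ for all objects $a,b,c$, and it is braided from $\varepsilon$ to $\widetilde\varepsilon$ when $U_{b,a}\circ\widetilde\varepsilon_{a,b}=\varepsilon_{a,b}\circ U_{a,b}$ for all objects $a,b$. *)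

(* Defs.v *)
From mathcomp Require Import all_boot all_order all_algebra.
From mathcomp Require Import boolp classical_sets reals complex.

Set Implicit Arguments.
Unset Strict Implicit.
Unset Printing Implicit Defensive.
Import Order.TTheory GRing.Theory Num.Theory.
Local Open Scope ring_scope.

(* Finite-dimensional Hom spaces are built in by taking them in vectType, which
   also makes the completeness of the Hom norms automatic. *)
Record cstar_category (R : realType) : Type := CStarCategory {
  Ob : Type;
  Mor : Ob -> Ob -> vectType R[i];
  idm : forall a, Mor a a;
  compm : forall a b c, Mor b c -> Mor a b -> Mor a c;
  adj : forall a b, Mor a b -> Mor b a;
  hnorm : forall a b, Mor a b -> R;
  comp1m : forall a b (f : Mor a b), compm (idm b) f = f;
  compm1 : forall a b (f : Mor a b), compm f (idm a) = f;
  compA : forall a b c d (h : Mor c d) (g : Mor b c) (f : Mor a b),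
    compm h (compm g f) = compm (compm h g) f;
  comp_linearl : forall a b c (z : R[i]) (g g' : Mor b c) (f : Mor a b),
    compm (z *: g + g') f = z *: compm g f + compm g' f;
  comp_linearr : forall a b c (z : R[i]) (g : Mor b c) (f f' : Mor a b),
    compm g (z *: f + f') = z *: compm g f + compm g f';
  adj_antilinear : forall a b (z : R[i]) (f f' : Mor a b),
    adj (z *: f + f') = (z^*)%R *: adj f + adj f';
  adjK : forall a b (f : Mor a b), adj (adj f) = f;
  adj_comp : forall a b c (g : Mor b c) (f : Mor a b),
    adj (compm g f) = compm (adj f) (adj g);
  hnorm_eq0 : forall a b (f : Mor a b), hnorm f = 0 -> f = 0;
  hnormD : forall a b (f g : Mor a b), hnorm (f + g) <= hnorm f + hnorm g;
  hnormZ : forall a b (z : R[i]) (f : Mor a b),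
    hnorm (z *: f) = Normc.normc z * hnorm f;
  hnorm_comp : forall a b c (g : Mor b c) (f : Mor a b),
    hnorm (compm g f) <= hnorm g * hnorm f;
  hnorm_cstar : forall a b (f : Mor a b), hnorm (compm (adj f) f) = hnorm f ^+ 2;
  (* [adj f o f] is a positive element of the C*-algebra [Mor a a] *)
  adj_pos : forall a b (f : Mor a b),
    exists g : Mor a a, compm (adj f) f = compm (adj g) g
}.

Arguments idm {R} _ _.
Arguments compm {R _ a b c} _ _.
Arguments adj {R _ a b} _.
Arguments hnorm {R _ a b} _.

Declare Scope cat_scope.
Delimit Scope cat_scope with cat.
Notation "g ∘ f" := (compm g f) (at level 40, left associativity) : cat_scope.
Notation "f ^†" := (adj f) (at level 2, format "f ^†") : cat_scope.
Notation "'1_' a" := (idm _ a) (at level 8, a at level 2, format "1_ a") : cat_scope.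
Local Open Scope cat_scope.

Section CStarCategory.
Context {R : realType} {C : cstar_category R}.
Implicit Types a b c : Ob C.

Definition unitary a b (u : Mor a b) : Prop := u^† ∘ u = 1_a /\ u ∘ u^† = 1_b.

Definition unitarily_iso a b : Prop := exists u : Mor a b, unitary u.

Definition irreducible a : Prop :=
  1_a <> 0 /\ forall f : Mor a a, exists z : R[i], f = z *: 1_a.

(* A morphism [f : Mor a b] "is the identity" when [a] and [b] are the same
   object and [f] is the identity transported along that equality. *)
Definition is_identity a b (f : Mor a b) : Prop :=
  exists e : a = b, f = eq_rect a (fun x => Mor a x) (1_a) b e.

End CStarCategory.

Definition has_direct_sums (R : realType) (C : cstar_category R) : Prop :=
  forall (m : nat) (a : 'I_m -> Ob C),
    exists (s : Ob C) (v : forall i, Mor (a i) s),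
      (forall i, (v i)^† ∘ v i = 1_(a i)) /\ \sum_i v i ∘ (v i)^† = 1_s.

Definition has_subobjects (R : realType) (C : cstar_category R) : Prop :=
  forall (a : Ob C) (p : Mor a a), p^† = p -> p ∘ p = p ->
    exists (b : Ob C) (v : Mor b a), v^† ∘ v = 1_b /\ v ∘ v^† = p.

(* Tensor product, tensor unit and unit constraints. The associator is kept
   apart, since several associators are considered on the same tensor data. *)
Record tensor_data (R : realType) (C : cstar_category R) : Type := TensorData {
  tob : Ob C -> Ob C -> Ob C;
  thom : forall a b a' b' : Ob C,
    Mor a a' -> Mor b b' -> Mor (tob a b) (tob a' b');
  tunit : Ob C;
  lunit : forall a, Mor (tob tunit a) a;
  runit : forall a, Mor (tob a tunit) a;
  thom1 : forall a b, thom (1_a) (1_b) = 1_(tob a b);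
  thom_comp : forall a b c a' b' c' (g : Mor b c) (f : Mor a b)
      (g' : Mor b' c') (f' : Mor a' b'),
    thom (g ∘ f) (g' ∘ f') = thom g g' ∘ thom f f';
  thom_linearl : forall a b a' b' (z : R[i]) (f f' : Mor a a') (g : Mor b b'),
    thom (z *: f + f') g = z *: thom f g + thom f' g;
  thom_linearr : forall a b a' b' (z : R[i]) (f : Mor a a') (g g' : Mor b b'),
    thom f (z *: g + g') = z *: thom f g + thom f g';
  thom_adj : forall a b a' b' (f : Mor a a') (g : Mor b b'),
    (thom f g)^† = thom (f^†) (g^†);
  lunit_unitary : forall a, unitary (lunit a);
  runit_unitary : forall a, unitary (runit a);
  lunit_natural : forall a b (f : Mor a b),
    f ∘ lunit a = lunit b ∘ thom (1_tunit) f;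
  runit_natural : forall a b (f : Mor a b),
    f ∘ runit a = runit b ∘ thom f (1_tunit)
}.

Arguments thom {R C} _ {a b a' b'} _ _.

Section Tensor.
Context {R : realType} {C : cstar_category R} (T : tensor_data C).
Implicit Types a b c : Ob C.
Local Notation "a ⊗ b" := (tob T a b) (at level 39, left associativity).
Local Notation "f ⊠ g" := (thom T f g) (at level 39, left associativity).
Local Notation I := (tunit T).
Local Notation λ := (lunit T).
Local Notation ρ := (runit T).

Definition associator_family : Type :=
  forall a b c, Mor ((a ⊗ b) ⊗ c) (a ⊗ (b ⊗ c)).

Definition braiding_family : Type := forall a b, Mor (a ⊗ b) (b ⊗ a).

Definition tensor_endo_family : Type := forall a b, Mor (a ⊗ b) (a ⊗ b).

Record unitary_associator (α : associator_family) : Prop := {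
  assoc_unitary : forall a b c, unitary (α a b c);
  assoc_natural : forall a b c a' b' c'
      (f : Mor a a') (g : Mor b b') (h : Mor c c'),
    α a' b' c' ∘ ((f ⊠ g) ⊠ h) = (f ⊠ (g ⊠ h)) ∘ α a b c;
  assoc_pentagon : forall a b c d,
    α a b (c ⊗ d) ∘ α (a ⊗ b) c d
    = (1_a ⊠ α b c d) ∘ α a (b ⊗ c) d ∘ (α a b c ⊠ 1_d);
  assoc_triangle : forall a b, (1_a ⊠ λ b) ∘ α a I b = ρ a ⊠ 1_b
}.

Definition strict (α : associator_family) : Prop :=
  [/\ forall a b c, is_identity (α a b c),
      forall a, is_identity (λ a)
    & forall a, is_identity (ρ a)].

Section Associator.
Variable α : associator_family.

(* (s^† x 1_a) o (1_a x r) = 1_a, with the constraints made explicit *)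
Definition conjugate_eq a b (r : Mor I (b ⊗ a)) (s : Mor I (a ⊗ b)) : Prop :=
  λ a ∘ (s^† ⊠ 1_a) ∘ (α a b a)^† ∘ (1_a ⊠ r) ∘ (ρ a)^† = 1_a.

Definition conjugate_solution a b
    (r : Mor I (b ⊗ a)) (s : Mor I (a ⊗ b)) : Prop :=
  conjugate_eq r s /\ conjugate_eq s r.

Definition has_conjugates : Prop :=
  forall a, exists (b : Ob C) (r : Mor I (b ⊗ a)) (s : Mor I (a ⊗ b)),
    conjugate_solution r s.

(* Standardness, in the form it takes for an irreducible object [a] (the only
   case in which it is used): r and s have the same norm. *)
Definition standard_solution a b
    (r : Mor I (b ⊗ a)) (s : Mor I (a ⊗ b)) : Prop :=
  conjugate_solution r s /\ r^† ∘ r = s^† ∘ s.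

(* [spectrum irr]: [irr] lists one representative of each unitary isomorphism
   class of irreducible objects, the class of the tensor unit being labelled 0. *)
Definition spectrum n (irr : 'I_n.+1 -> Ob C) : Prop :=
  [/\ forall i, irreducible (irr i),
      forall i j, unitarily_iso (irr i) (irr j) -> i = j,
      forall a, irreducible a -> exists i, unitarily_iso a (irr i)
    & unitarily_iso (irr ord0) I].

Record unitary_fusion : Prop := {
  fusion_associator : unitary_associator α;
  fusion_direct_sums : has_direct_sums C;
  fusion_subobjects : has_subobjects C;
  fusion_conjugates : has_conjugates;
  fusion_finite : exists n (irr : 'I_n.+1 -> Ob C), spectrum irr;
  fusion_unit : irreducible I
}.

Record unitary_braiding (ε : braiding_family) : Prop := {
  braid_unitary : forall a b, unitary (ε a b);
  braid_natural : forall a b a' b' (f : Mor a a') (g : Mor b b'),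
    ε a' b' ∘ (f ⊠ g) = (g ⊠ f) ∘ ε a b;
  braid_hexagonr : forall a b c,
    α b c a ∘ ε a (b ⊗ c) ∘ α a b c
    = (1_b ⊠ ε a c) ∘ α b a c ∘ (ε a b ⊠ 1_c);
  braid_hexagonl : forall a b c,
    (α c a b)^† ∘ ε (a ⊗ b) c ∘ (α a b c)^†
    = (ε a c ⊠ 1_b) ∘ (α a c b)^† ∘ (1_a ⊠ ε b c)
}.

(* For irreducible [a] the sets below are singletons; the default value 0 of
   [xget] plays no role. *)
Definition qdim a : R[i] :=
  xget 0 [set d : R[i] | exists (b : Ob C) (r : Mor I (b ⊗ a)) (s : Mor I (a ⊗ b)),
    standard_solution r s /\ r^† ∘ r = d *: 1_I]%classic.

Definition twist_loop (ε : braiding_family) a b (r : Mor I (b ⊗ a)) : Mor a a :=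
  λ a ∘ (r^† ⊠ 1_a) ∘ (α b a a)^† ∘ (1_b ⊠ ε a a) ∘ α b a a
    ∘ (r ⊠ 1_a) ∘ (λ a)^†.

Definition twist (ε : braiding_family) a : R[i] :=
  xget 0 [set w : R[i] | exists (b : Ob C) (r : Mor I (b ⊗ a)) (s : Mor I (a ⊗ b)),
    standard_solution r s /\ twist_loop ε r = w *: 1_a]%classic.

Section ModularData.
Variables (ε : braiding_family) (n : nat) (irr : 'I_n.+1 -> Ob C).
Local Notation d i := (qdim (irr i)).
Local Notation ω i := (twist ε (irr i)).

Definition fusion_mult (i j k : 'I_n.+1) : nat :=
  \dim (fullv : {vspace Mor (irr k) (irr i ⊗ irr j)}).

Definition Ymx : 'M[R[i]]_n.+1 :=
  \matrix_(i, j) \sum_k (fusion_mult i j k)%:R * (ω i * ω j / ω k) * d k.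

Definition gauss_sum : R[i] := \sum_i d i ^+ 2 * (ω i)^-1.

Definition Smx : 'M[R[i]]_n.+1 := `|gauss_sum|^-1 *: Ymx.

Definition Tmx : 'M[R[i]]_n.+1 :=
  \matrix_(i, j) (3.-root (gauss_sum / `|gauss_sum|) * ω i * (i == j)%:R).

End ModularData.

Record umtc (ε : braiding_family) : Prop := {
  umtc_fusion : unitary_fusion;
  umtc_braiding : unitary_braiding ε;
  umtc_modular : forall n (irr : 'I_n.+1 -> Ob C),
    spectrum irr -> Smx ε irr \in unitmx
}.

End Associator.

(* (Id, U, 1) from the tensor category with associator [α0] to the one with
   associator [α]; for strict [α0] the factor [α0 a b c] is an identity. *)
Record unitary_tensor_equivalence
    (α0 α : associator_family) (U : tensor_endo_family) : Prop := {
  equiv_unitary : forall a b, unitary (U a b);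
  equiv_natural : forall a b a' b' (f : Mor a a') (g : Mor b b'),
    U a' b' ∘ (f ⊠ g) = (f ⊠ g) ∘ U a b;
  equiv_lunit : forall a, λ a ∘ U I a = λ a;
  equiv_runit : forall a, ρ a ∘ U a I = ρ a;
  equiv_assoc : forall a b c,
    U a (b ⊗ c) ∘ (1_a ⊠ U b c) ∘ α a b c
    = α0 a b c ∘ U (a ⊗ b) c ∘ (U a b ⊠ 1_c)
}.

Definition braided (U : tensor_endo_family) (ε ε' : braiding_family) : Prop :=
  forall a b, U b a ∘ ε' a b = ε a b ∘ U a b.

End Tensor.

(* The rank and the spectrum, shared by the data being compared, are fixed by
   the parameters [n] and [irr]. *)
Record modular_data (R : realType) (n : nat) : Type := ModularData {
  md_N : 'I_n.+1 -> 'I_n.+1 -> 'I_n.+1 -> nat;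
  md_S : 'M[R[i]]_n.+1;
  md_T : 'M[R[i]]_n.+1
}.

Definition modular_data_of (R : realType) (C : cstar_category R)
    (T : tensor_data C) (α : associator_family T) (ε : braiding_family T)
    (n : nat) (irr : 'I_n.+1 -> Ob C) : modular_data R n :=
  ModularData (fusion_mult T irr) (Smx α ε irr) (Tmx α ε irr).

(* Main.v *)
From HB Require Import structures.
Require Import Defs.
From mathcomp Require Import all_boot all_order all_algebra.
From mathcomp Require Import boolp classical_sets reals complex.

Set Implicit Arguments.
Unset Strict Implicit.
Unset Printing Implicit Defensive.
Import Order.TTheory GRing.Theory Num.Theory.
Local Open Scope ring_scope.
Local Open Scope cat_scope.

(** Let [U] be a natural family of unitaries of the tensor products which is
    trivial when one of the factors is the unit. Transporting the associator along
    [U] gives another unitary fusion structure, equivalent to the first one by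
    [(Id, U, 1)]; the pentagon and the conjugate equations follow from the
    naturality of [U]. If moreover [U b a ∘ ε' a b = ε a b ∘ U a b], the hexagons
    of [ε] become those of [ε'] for the new associator ([transport_braiding]).
    The problem is thus to find such a family [U].

    By semisimplicity [U] can be prescribed arbitrarily on pairs of irreducible
    objects [a_i], [a_j] ([extend]). For [i < j] take [U i j = 1], which forces
    [U j i = ε i j ∘ (ε' i j)^†]; the remaining condition is that the double
    braidings for [ε] and [ε'] agree. By balancing, the double braiding acts on
    [Mor a_k (a_i ⊗ a_j)] as the scalar [ω k / (ω i * ω j)], and the matrix T
    determines the twists because [ω 0 = 1].

    For [i = j] the two self-braidings must be unitarily conjugate. On each
    [Mor a_k (a_i ⊗ a_i)] they are unitaries with the same scalar square, so they
    are conjugate as soon as they have the same trace [t k]. To compute these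
    traces, encircle two parallel strands [a_i] by a closed strand [a_j], let them
    cross and close them up. Decomposing [a_i ⊗ a_i] gives
    [\sum_k t k * (Y k j)^*]. On the other hand the Yang-Baxter equation moves the
    crossing away from one strand, whose closure contributes a twist, and what is
    left is [a_i] winding twice around [a_j]:
    [ω i * \sum_l N i j l * (ω l / (ω i * ω j)) ^+ 2 * d l]
    ([self_braiding_trace]). This depends only on the modular data, and [Y] is
    invertible, so the traces agree ([self_braiding_conjugate]).

    The diagrams are computed in the two-category of right module endofunctors of
    [C]: an object [a] is replaced by the functor [x |-> a ⊗ x], a morphism by a
    natural family compatible with the module structures. Composition of functors
    is strictly associative on objects, so associators disappear from the
    calculations. Standard solutions for irreducible objects give spherical duals
    ([dual]), which compose, and the trace property [ptr_cyclic] of the partial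
    traces follows from sphericality by a positivity argument. *)

(** * Linear algebra in a C*-category *)

Section Linear.
Context {R : realType} {C : cstar_category R}.
Implicit Types a b c : Ob C.

Lemma compmA a b c d (h : Mor c d) (g : Mor b c) (f : Mor a b) :
  h ∘ (g ∘ f) = h ∘ g ∘ f.
Proof. exact: Defs.compA. Qed.

Lemma compDl a b c (g g' : Mor b c) (f : Mor a b) :
  (g + g') ∘ f = g ∘ f + g' ∘ f.
Proof. by rewrite -[g]scale1r comp_linearl !scale1r. Qed.

Lemma compDr a b c (g : Mor b c) (f f' : Mor a b) :
  g ∘ (f + f') = g ∘ f + g ∘ f'.
Proof. by rewrite -[f]scale1r comp_linearr !scale1r. Qed.

Lemma comp0m a b c (f : Mor a b) : (0 : Mor b c) ∘ f = 0.
Proof. by apply: (addIr (0 ∘ f)); rewrite -compDl !add0r. Qed.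

Lemma compm0 a b c (g : Mor b c) : g ∘ (0 : Mor a b) = 0.
Proof. by apply: (addIr (g ∘ 0)); rewrite -compDr !add0r. Qed.

Lemma compZl a b c (z : R[i]) (g : Mor b c) (f : Mor a b) :
  (z *: g) ∘ f = z *: (g ∘ f).
Proof. by rewrite -[z *: g]addr0 comp_linearl comp0m addr0. Qed.

Lemma compZr a b c (z : R[i]) (g : Mor b c) (f : Mor a b) :
  g ∘ (z *: f) = z *: (g ∘ f).
Proof. by rewrite -[z *: f]addr0 comp_linearr compm0 addr0. Qed.

Lemma compNl a b c (g : Mor b c) (f : Mor a b) : (- g) ∘ f = - (g ∘ f).
Proof. by rewrite -scaleN1r compZl scaleN1r. Qed.

Lemma compNr a b c (g : Mor b c) (f : Mor a b) : g ∘ (- f) = - (g ∘ f).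
Proof. by rewrite -scaleN1r compZr scaleN1r. Qed.

Lemma comp_suml a b c J (s : seq J) (P : pred J) (F : J -> Mor b c)
    (f : Mor a b) :
  (\sum_(j <- s | P j) F j) ∘ f = \sum_(j <- s | P j) (F j ∘ f).
Proof.
by apply: (big_morph (fun g => g ∘ f)) => [g g'|]; rewrite ?compDl ?comp0m.
Qed.

Lemma comp_sumr a b c J (s : seq J) (P : pred J) (F : J -> Mor a b)
    (g : Mor b c) :
  g ∘ (\sum_(j <- s | P j) F j) = \sum_(j <- s | P j) (g ∘ F j).
Proof.
by apply: (big_morph (fun f => g ∘ f)) => [f f'|]; rewrite ?compDr ?compm0.
Qed.

Lemma adjD a b (f g : Mor a b) : (f + g)^† = f^† + g^†.
Proof. by rewrite -[f]scale1r adj_antilinear rmorph1 !scale1r. Qed.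

Lemma adj0 a b : (0 : Mor a b)^† = 0.
Proof. by apply: (addIr (0^†)); rewrite -adjD !add0r. Qed.

Lemma adjZ a b z (f : Mor a b) : (z *: f)^† = (z^*)%R *: f^†.
Proof. by rewrite -[z *: f]addr0 adj_antilinear adj0 addr0. Qed.

Lemma adjN a b (f : Mor a b) : (- f)^† = - f^†.
Proof. by rewrite -scaleN1r adjZ rmorphN1 scaleN1r. Qed.

Lemma adj_sum a b J (s : seq J) (P : pred J) (F : J -> Mor a b) :
  (\sum_(j <- s | P j) F j)^† = \sum_(j <- s | P j) (F j)^†.
Proof. by apply: (big_morph (fun f => f^†)) => [f f'|]; rewrite ?adjD ?adj0. Qed.

Lemma adj1 a : (1_a : Mor a a)^† = 1_a.
Proof. by rewrite -[RHS]adjK -[in RHS](compm1 ((1_a)^†)) adj_comp adjK compm1. Qed.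

Lemma adj_eq a b (f g : Mor a b) : f^† = g^† -> f = g.
Proof. by move=> e; rewrite -[f]adjK e adjK. Qed.

(** An equation between binary composites, as a rewriting rule at the end of
    a longer composite associated to the left. *)
Lemma rea a b c (g : Mor b c) (f : Mor a b) (h : Mor a c) :
  g ∘ f = h -> forall d (k : Mor c d), k ∘ g ∘ f = k ∘ h.
Proof. by move=> e d k; rewrite -compmA e. Qed.

Lemma cstar_eq0 a b (f : Mor a b) : f^† ∘ f = 0 -> f = 0.
Proof.
move=> e; apply: hnorm_eq0; apply/eqP; rewrite -sqrf_eq0 -hnorm_cstar e.
by rewrite -(scale0r (0 : Mor a a)) hnormZ /Normc.normc /= expr0n /= addr0 sqrtr0 mul0r.
Qed.

Lemma unitaryV a b (u : Mor a b) : unitary u -> unitary (u^†).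
Proof. by case=> e1 e2; split; rewrite adjK. Qed.

Lemma unitary1 a : unitary (1_a : Mor a a).
Proof. by rewrite /unitary adj1 comp1m. Qed.

Lemma unitaryM a b c (u : Mor b c) (v : Mor a b) :
  unitary u -> unitary v -> unitary (u ∘ v).
Proof.
move=> [u1 u2] [v1 v2]; rewrite /unitary adj_comp !compmA; split.
  by rewrite -(compmA (v^†)) u1 compm1.
by rewrite -(compmA u) v2 compm1.
Qed.

Lemma unitary_lcan a b c (u : Mor b c) (f g : Mor a b) :
  unitary u -> u ∘ f = u ∘ g -> f = g.
Proof.
move=> [u1 _] e; rewrite -[f]comp1m -[g]comp1m -u1 -!compmA.
by congr (_ ∘ _).
Qed.

Lemma unitary_rcan a b c (u : Mor a b) (f g : Mor b c) :
  unitary u -> f ∘ u = g ∘ u -> f = g.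
Proof. by move=> [_ u1] e; rewrite -[f]compm1 -[g]compm1 -u1 !compmA e. Qed.

Lemma irreducible_scalar a (f : Mor a a) :
  irreducible a -> exists z : R[i], f = z *: 1_a.
Proof. by case=> _; apply. Qed.

Lemma scalar_inj a (z w : R[i]) :
  irreducible a -> z *: 1_a = w *: 1_a :> Mor a a -> z = w.
Proof.
case=> a0 _ /eqP; rewrite -subr_eq0 -scalerBl scaler_eq0 subr_eq0.
by case/orP=> /eqP.
Qed.

(** Positivity of [f^† ∘ f] reduces, over an irreducible object, to that of a
    complex number. *)
Lemma adj_scalar_pos a b (f : Mor a b) : irreducible a ->
  exists2 z : R[i], 0 <= z & f^† ∘ f = z *: 1_a.
Proof.
move=> ia; case: (adj_pos f) => g ->.
case: (irreducible_scalar g ia) => w ->; exists (w^* * w).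
  by rewrite mulrC mul_conjC_ge0.
by rewrite adjZ adj1 compZl compZr comp1m scalerA.
Qed.

Lemma pos_scalar a b (f : Mor a b) z : irreducible a ->
  f^† ∘ f = z *: 1_a -> 0 <= z.
Proof.
by move=> ia; case: (adj_scalar_pos f ia) => w w0 -> /(scalar_inj ia) <-.
Qed.

(** A nonzero morphism from an irreducible object is a multiple of an isometry. *)
Lemma normalize a b (f : Mor a b) : irreducible a -> f <> 0 ->
  exists2 z : R[i], z != 0 & (z *: f)^† ∘ (z *: f) = 1_a.
Proof.
move=> ia f0; case: (adj_scalar_pos f ia) => w w0 e.
have wn0 : w != 0.
  by apply/eqP => w_0; apply: f0; apply: cstar_eq0; rewrite e w_0 scale0r.
have sw : sqrtC w != 0 by rewrite sqrtC_eq0.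
exists (sqrtC w)^-1; first by rewrite invr_eq0.
rewrite adjZ compZl compZr e !scalerA conj_Creal; last first.
  by rewrite rpredV ger0_real // sqrtC_ge0.
by rewrite -invfM -expr2 sqrtCK mulVf // scale1r.
Qed.

(** An isometry between irreducible objects is unitary. *)
Lemma isometry_unitary a b (f : Mor a b) : irreducible a -> irreducible b ->
  f^† ∘ f = 1_a -> unitary f.
Proof.
move=> ia ib e; split=> //; case: (irreducible_scalar (f ∘ f^†) ib) => z ez.
suff z1 : z = 1 by rewrite ez z1 scale1r.
have : z *: 1_a = 1 *: 1_a :> Mor a a.
  rewrite -{1}e -[z *: (_ ∘ _)]compZr.
  have -> : z *: f = (f ∘ f^†) ∘ f by rewrite ez compZl comp1m.
  by rewrite -(compmA f) e compm1 e scale1r.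
by move/(scalar_inj ia).
Qed.

Lemma unitary_irreducible a b (u : Mor a b) :
  unitary u -> irreducible a -> irreducible b.
Proof.
move=> [u1 u2] [a0 ia]; split=> [b0|f].
  by apply: a0; rewrite -u1 -[u]comp1m b0 comp0m compm0.
case: (ia (u^† ∘ f ∘ u)) => z e; exists z.
have -> : f = u ∘ (u^† ∘ f ∘ u) ∘ u^†.
  by rewrite !compmA u2 comp1m -compmA u2 compm1.
by rewrite e compZr compZl compm1 u2.
Qed.

End Linear.

(** * Projections and irreducible subobjects *)

Section Semisimple.
Context {R : realType} {C : cstar_category R}.
Implicit Types a b c : Ob C.

(** [peval p f] is the value of the polynomial [p] at the endomorphism [f]. *)
Definition peval a (p : {poly R[i]}) (f : Mor a a) : Mor a a :=
  \sum_(i < size p) p`_i *: iter i (compm f) (1_a).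

Lemma peval_wide a (p : {poly R[i]}) (f : Mor a a) m : (size p <= m)%N ->
  peval p f = \sum_(i < m) p`_i *: iter i (compm f) (1_a).
Proof.
move=> h; rewrite /peval (big_ord_widen m (fun i => p`_i *: iter i (compm f) (1_a))) //.
rewrite big_mkcond; apply: eq_bigr => i _; case: ltnP => // hi.
by rewrite nth_default // scale0r.
Qed.

Lemma pevalXsub a (p : {poly R[i]}) (f : Mor a a) z :
  peval (('X - z%:P) * p) f = f ∘ peval p f - z *: peval p f.
Proof.
rewrite (@peval_wide _ (_ * p) f (size p).+1); last first.
  by rewrite (leq_trans (size_polyMleq _ _)) // size_XsubC.
rewrite {2}(@peval_wide _ p f (size p).+1) //.
rewrite big_ord_recl [in X in _ - z *: X]big_ord_recl /peval comp_sumr.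
rewrite scalerDr opprD [RHS]addrCA; congr (_ + _).
  by rewrite mulrBl coefB coefXM coefCM sub0r scaleNr scalerA.
rewrite scaler_sumr -sumrB; apply: eq_bigr => i _.
by rewrite compZr scalerA -scalerBl mulrBl coefB coefXM coefCM.
Qed.

Lemma peval_commute a p (f h : Mor a a) :
  h ∘ f = f ∘ h -> h ∘ peval p f = peval p f ∘ h.
Proof.
move=> e; rewrite /peval comp_sumr comp_suml; apply: eq_bigr => i _.
rewrite compZl compZr; congr (_ *: _).
elim: (val i) => [|k IH] /=; first by rewrite comp1m compm1.
by rewrite compmA e -compmA IH compmA.
Qed.

Lemma peval_eigen a p (f g : Mor a a) z :
  f ∘ g = z *: g -> peval p f ∘ g = p.[z] *: g.
Proof.
move=> e; rewrite /peval horner_coef comp_suml scaler_suml; apply: eq_bigr => i _.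
rewrite compZl -scalerA; congr (_ *: _).
elim: (val i) => [|k IH] /=; first by rewrite comp1m expr0 scale1r.
by rewrite -compmA IH compZr e scalerA exprSr.
Qed.

Lemma peval_annihilator a (f : Mor a a) :
  exists2 p : {poly R[i]}, p != 0 & peval p f = 0.
Proof.
set d := \dim (fullv : {vspace Mor a a}).
pose X : d.+1.-tuple (Mor a a) := [tuple iter i (compm f) (1_a) | i < d.+1].
have nf : ~~ free X.
  apply/negP => fX; have := dimvS (subvf <<X>>%VS).
  by rewrite (eqP fX) size_tuple ltnn.
have [k [k0 [i ki]]] : exists k : 'I_d.+1 -> R[i],
    \sum_(i < d.+1) k i *: X`_i = 0 /\ exists i, k i != 0.
  apply: contrapT => h; move/negP: nf; apply; apply/freeP => k k0 i.
  by apply/eqP; apply: contrapT => /negP ki; apply: h; exists k; split=> //; exists i.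
exists (\poly_(i < d.+1) k (inord i)).
  apply/eqP => /(congr1 (fun p : {poly _} => p`_i)) /eqP.
  by rewrite coef_poly ltn_ord coef0 inord_val (negbTE ki).
rewrite (peval_wide _ (size_poly _ _)) -[RHS]k0; apply: eq_bigr => j _.
by rewrite coef_poly ltn_ord inord_val (nth_map ord0) ?size_enum_ord // nth_ord_enum.
Qed.

(** Some nonzero polynomial in [f] is an eigenvector of the multiplication by
    [f]: strip the linear factors off an annihilating polynomial, one at a time,
    until its value at [f] is no longer zero. *)
Lemma peval_eigenvector a (f : Mor a a) : 1_a <> 0 :> Mor a a ->
  exists q z, peval q f <> 0 /\ f ∘ peval q f = z *: peval q f.
Proof.
move=> a0; case: (peval_annihilator f) => p.
have [m] := ubnP (size p); elim: m p => // m IH p pm p0 pf.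
have [|sp] := leqP (size p) 1.
  move/size1_polyC => pc; case: a0.
  have c0 : p`_0 != 0 by apply: contraNneq p0 => c0; rewrite pc c0.
  apply/eqP; have := pf; rewrite pc /peval size_polyC c0 big_ord1 /= coefC /=.
  by move/eqP; rewrite scaler_eq0 (negbTE c0).
have [z pz] : exists z, root p z.
  by apply/closed_rootP; rewrite neq_ltn sp orbT.
case/factor_theorem: pz => q e; rewrite mulrC in e.
have [q0|/eqP q0] := pselect (peval q f = 0); last first.
  exists q, z; split; first exact/eqP.
  by apply/eqP; rewrite -subr_eq0 -pevalXsub -e pf.
have qn0 : q != 0 by apply: contraNneq p0 => q_0; rewrite e q_0 mulr0.
apply: (IH q) => //; move: pm.
by rewrite e mulrC (size_Mmonic qn0 (monicXsubC z)) size_XsubC addn2.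
Qed.

(** For a normal idempotent [e] the C*-identity kills [e - e^† ∘ e]. *)
Lemma normal_idempotent a (e : Mor a a) :
  e^† ∘ e = e ∘ e^† -> e ∘ e = e -> e^† = e.
Proof.
move=> en ee.
have e2 : e^† ∘ e^† = e^† by rewrite -adj_comp ee.
have h1 : e^† ∘ (e^† ∘ e) = e^† ∘ e by rewrite compmA e2.
have h2 : e^† ∘ e ∘ e = e^† ∘ e by rewrite -compmA ee.
have h3 : e^† ∘ e ∘ (e^† ∘ e) = e^† ∘ e.
  by rewrite compmA -(compmA (e^†) e (e^†)) -en !compmA e2 h2.
have h : e - e^† ∘ e = 0.
  apply: cstar_eq0; rewrite adjD adjN adj_comp adjK.
  by rewrite compDl !compDr !compNl !compNr h1 h2 h3 opprK subrr add0r addNr.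
move/eqP: h; rewrite subr_eq0 => /eqP h.
by rewrite h adj_comp adjK.
Qed.

(** The eigenvector [g] of [peval_eigenvector] is normal and [g ∘ g] is a
    multiple of [g], nonzero by the C*-identity, so a multiple of [g] is a
    projection. *)
Lemma selfadjoint_projection a (f : Mor a a) : 1_a <> 0 :> Mor a a ->
  f^† = f -> ~ (exists z, f = z *: 1_a) ->
  exists p : Mor a a, [/\ p^† = p, p ∘ p = p, p <> 0 & p <> 1_a].
Proof.
move=> a0 fs fns; case: (peval_eigenvector f a0) => q [z []].
set g := peval q f => g0 fg.
have gf : g ∘ f = f ∘ g by rewrite /g -peval_commute.
have gn : g^† ∘ g = g ∘ g^†.
  apply: peval_commute; apply: adj_eq.
  by rewrite !adj_comp adjK fs gf.
have gg : g ∘ g = q.[z] *: g by exact: peval_eigen.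
have x0 : q.[z] != 0.
  apply/eqP => x0; apply: g0; apply: cstar_eq0; apply: cstar_eq0.
  rewrite adj_comp adjK {2}gn !compmA -(compmA (g^†)) gg x0 scale0r.
  by rewrite compm0 comp0m.
pose e := q.[z]^-1 *: g.
have ee : e ∘ e = e.
  by rewrite /e compZl compZr gg !scalerA -mulrA mulVf // mulr1.
have en : e^† ∘ e = e ∘ e^†.
  by rewrite /e adjZ !compZl !compZr gn !scalerA mulrC.
exists e; split=> //.
- exact: normal_idempotent.
- by move/eqP; rewrite scaler_eq0 invr_eq0 (negbTE x0) => /eqP.
- move=> e1; apply: fns; exists z.
  rewrite -[LHS]compm1 -[in LHS]e1 /e compZr fg scalerA mulrC -scalerA.
  by rewrite -/e e1.
Qed.

(** Some selfadjoint endomorphism of a reducible object is not a scalar: the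
    real or the imaginary part of a nonscalar one. *)
Lemma nontrivial_projection a : 1_a <> 0 :> Mor a a -> ~ irreducible a ->
  exists p : Mor a a, [/\ p^† = p, p ∘ p = p, p <> 0 & p <> 1_a].
Proof.
move=> a0 ni.
have [f fns] : exists f : Mor a a, ~ exists z, f = z *: 1_a.
  by apply: contrapT => h; apply: ni; split=> // f; apply: contrapT => hf; apply: h; exists f.
have [[x ex]|] := pselect (exists x, f + f^† = x *: 1_a); last first.
  by apply: selfadjoint_projection; rewrite // adjD adjK addrC.
apply: (@selfadjoint_projection _ ('i *: (f - f^†))) => //.
  by rewrite adjZ adjD adjN adjK conjCi -opprB scalerN scaleNr opprK.
case=> y ey; apply: fns; exists ((x - 'i * y) / 2).
have e2 : f - f^† = (- 'i * y) *: 1_a.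
  by rewrite -scalerA -ey scalerA mulNr -expr2 sqrCi opprK scale1r.
have : 2 *: f = (x - 'i * y) *: 1_a.
  rewrite scalerBl -ex -scaleNr -mulNr -e2 scaler_nat mulr2n.
  by rewrite addrACA subrr addr0.
by move/(congr1 (fun g => 2^-1 *: g)); rewrite !scalerA mulVf ?pnatr_eq0 // scale1r mulrC.
Qed.

(** By induction on the dimension of the endomorphism algebra, which drops when
    passing to the image of a nontrivial projection. *)
Lemma irreducible_subobject a : has_subobjects C -> 1_a <> 0 :> Mor a a ->
  exists b (v : Mor b a), irreducible b /\ v^† ∘ v = 1_b.
Proof.
move=> sub; have [m] := ubnP (\dim (fullv : {vspace Mor a a})).
elim: m a => // m IH a dm a0.
have [ia|ni] := pselect (irreducible a).
  by exists a, (1_a); rewrite adj1 comp1m.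
case: (nontrivial_projection a0 ni) => p [ps pp p0 p1].
case: (sub a p ps pp) => b [v [v1 v2]].
have b0 : 1_b <> 0 :> Mor b b.
  by move=> b0; apply: p0; rewrite -v2 -[v]compm1 b0 compm0 comp0m.
case: (IH b) => //; last first.
  move=> c [w [ic w1]]; exists c, (v ∘ w); split=> //.
  by rewrite adj_comp !compmA -(compmA (w^†)) v1 compm1.
rewrite -ltnS; apply: leq_trans dm; rewrite ltnS.
have lin : linear (fun g : Mor b b => v ∘ g ∘ v^†).
  by move=> z g h; rewrite comp_linearr comp_linearl.
pose F : {linear Mor b b -> Mor a a} :=
  HB.pack (fun g : Mor b b => v ∘ g ∘ v^†) (GRing.isLinear.Build _ _ _ _ _ lin).
pose l := linfun F.
have lE g : l g = v ∘ g ∘ v^† by rewrite lfunE.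
have ker : lker l == 0%VS.
  apply/lker0P => g h; rewrite !lE => e.
  have {}e : v^† ∘ (v ∘ g ∘ v^†) ∘ v = v^† ∘ (v ∘ h ∘ v^†) ∘ v by rewrite e.
  by move: e; rewrite !compmA v1 !comp1m -!compmA v1 !compm1.
rewrite -(limg_dim_eq (f := l)) ?(eqP ker) ?capv0 //.
rewrite ltnNge; apply/negP => le.
(* otherwise conjugation by [v] is onto, and [v ∘ v^†] would be the identity *)
have full : (limg l == fullv)%VS by rewrite -dimv_leqif_eq ?subvf // eqn_leq le dimvS ?subvf.
have : 1_a \in limg l by rewrite (eqP full) memvf.
case/memv_imgP => g _; rewrite lE => e; apply: p1.
by rewrite -[LHS]compm1 e -v2 !compmA -(compmA v (v^†)) v1 compm1.
Qed.

End Semisimple.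

(** * Orthonormal bases and decompositions into irreducibles *)

Section Orthonormal.
Context {R : realType} {C : cstar_category R}.
Variables (k a : Ob C).
Hypothesis ik : irreducible k.

(** Orthonormality for the [1_k]-valued inner product [g^† ∘ f] of [Mor k a]. *)
Definition orthonormal (s : seq (Mor k a)) : Prop :=
  forall p q, (p < size s)%N -> (q < size s)%N ->
    (s`_p)^† ∘ s`_q = (p == q)%:R *: 1_k.

Lemma orthonormal_coef s (z : nat -> R[i]) p : orthonormal s -> (p < size s)%N ->
  (s`_p)^† ∘ (\sum_(i < size s) z i *: s`_i) = z p *: 1_k.
Proof.
move=> os ps; rewrite comp_sumr (bigD1 (Ordinal ps)) //= compZr os // eqxx scale1r.
rewrite big1 ?addr0 // => i ni; rewrite compZr os //.
rewrite [p == i](_ : _ = false) ?scale0r ?scaler0 //.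
by apply/negbTE; apply: contraNneq ni => e; apply/eqP/val_inj.
Qed.

Lemma orthonormal_free s : orthonormal s -> free s.
Proof.
move=> os; rewrite -[s]/(tval (in_tuple s)); apply/freeP => z z0 i.
have := @orthonormal_coef s (fun j => oapp z 0 (insub j)) i os (ltn_ord i).
rewrite (eq_bigr (fun j => z j *: (in_tuple s)`_j)); last by move=> j _; rewrite valK.
rewrite z0 compm0 valK /= => /esym /eqP.
by rewrite scaler_eq0 => /orP [/eqP //|/eqP k0]; case: ik => [].
Qed.

Lemma orthonormal_span s f : orthonormal s -> f \in <<s>>%VS ->
  \sum_(i < size s) s`_i ∘ ((s`_i)^† ∘ f) = f.
Proof.
move=> os fs; have e := coord_span (X := in_tuple s) fs.
rewrite [RHS]e; apply: eq_bigr => i _.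
have := @orthonormal_coef s (fun j => oapp (fun j => coord (in_tuple s) j f) 0 (insub j)) i os (ltn_ord i).
rewrite (eq_bigr (fun j => coord (in_tuple s) j f *: (in_tuple s)`_j)); last first.
  by move=> j _; rewrite valK.
by rewrite -e valK /= => ->; rewrite compZr compm1.
Qed.

Lemma orthonormal_extend (W : {vspace Mor k a}) s : orthonormal s ->
    {subset s <= W} -> (size s < \dim W)%N ->
  exists2 v, v \in W & orthonormal (rcons s v).
Proof.
move=> os sW sd.
have [f fW fs] : exists2 f, f \in W & f \notin <<s>>%VS.
  apply: contrapT => h.
  have : (W <= <<s>>)%VS.
    by apply/subvP => f fW; apply: contrapT => /negP fs; apply: h; exists f.
  move/dimvS; rewrite leqNgt => /negP; apply.
  by apply: leq_ltn_trans sd; rewrite dim_span.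
have scal i : exists z, (s`_i)^† ∘ f = z *: 1_k by exact: irreducible_scalar.
case: (choice scal) => z ez.
pose g := f - \sum_(i < size s) z i *: s`_i.
have zS : \sum_(i < size s) z i *: s`_i \in <<s>>%VS.
  by apply: rpred_sum => i _; apply: rpredZ; apply: memv_span; apply: mem_nth.
have sub : (<<s>> <= W)%VS by apply/span_subvP.
have g0 : g <> 0.
  by move/eqP; rewrite subr_eq0 => /eqP e; move: fs; rewrite e zS.
have go p : (p < size s)%N -> (s`_p)^† ∘ g = 0.
  by move=> ps; rewrite compDr compNr orthonormal_coef // ez subrr.
case: (normalize ik g0) => w w0 nw; exists (w *: g).
  by apply: rpredZ; apply: rpredB => //; apply: (subvP sub).
move=> p q; rewrite size_rcons !ltnS !nth_rcons => ps qs.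
case: (ltnP p (size s)) => [ps'|ps']; case: (ltnP q (size s)) => [qs'|qs'].
- exact: os.
- have -> : q = size s by apply/eqP; rewrite eqn_leq qs qs'.
  by rewrite eqxx compZr go // scaler0 (ltn_eqF ps') scale0r.
- have -> : p = size s by apply/eqP; rewrite eqn_leq ps ps'.
  rewrite eqxx -[_ ∘ _]adjK adj_comp adjK compZr go // scaler0 adj0.
  by rewrite (gtn_eqF qs') scale0r.
- have -> : q = size s by apply/eqP; rewrite eqn_leq qs qs'.
  have -> : p = size s by apply/eqP; rewrite eqn_leq ps ps'.
  by rewrite !eqxx nw scale1r.
Qed.

(** Gram-Schmidt, in a subspace of the Hom space. *)
Lemma orthonormal_basis (W : {vspace Mor k a}) :
  exists s, [/\ orthonormal s, {subset s <= W} & size s = \dim W].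
Proof.
have H : forall m, (m <= \dim W)%N ->
    exists s, [/\ orthonormal s, {subset s <= W} & size s = m].
  elim=> [|m IH] mW; first by exists [::].
  have [s [os sW sm]] := IH (ltnW mW); rewrite -sm in mW.
  have [v vW ov] := orthonormal_extend os sW mW.
  exists (rcons s v); split=> //; last by rewrite size_rcons sm.
  by move=> x; rewrite mem_rcons inE => /orP [/eqP -> //|/sW].
exact: H.
Qed.

Lemma orthonormal_full s : orthonormal s -> (<<s>> = fullv)%VS ->
  size s = \dim (fullv : {vspace Mor k a}).
Proof. by move=> os sf; have := orthonormal_free os; rewrite /free sf => /eqP. Qed.

Lemma orthonormal_basis_full s (W : {vspace Mor k a}) :
  orthonormal s -> {subset s <= W} -> size s = \dim W -> (<<s>> = W)%VS.
Proof.
move=> os sW ss; apply/eqP; rewrite -dimv_leqif_eq; last exact/span_subvP.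
by have := orthonormal_free os; rewrite /free => /eqP ->; rewrite ss.
Qed.

End Orthonormal.

Section Bases.
Context {R : realType} {C : cstar_category R} (n : nat) (irr : 'I_n.+1 -> Ob C).
Implicit Types a b c : Ob C.
Hypothesis irrI : forall i, irreducible (irr i).
Hypothesis irrN : forall i j, unitarily_iso (irr i) (irr j) -> i = j.
Hypothesis irrE : forall a, irreducible a -> exists i, unitarily_iso a (irr i).
Hypothesis sub : has_subobjects C.

(** Schur's lemma for distinct labels. *)
Lemma irr_hom0 i j (f : Mor (irr i) (irr j)) : i <> j -> f = 0.
Proof.
move=> ij; apply: contrapT => f0; case: (normalize (irrI i) f0) => z _ e.
by apply: ij; apply: irrN; exists (z *: f); apply: isometry_unitary.
Qed.

(** A decomposition of [a] into irreducibles: isometries [e k p] from [irr k],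
    with multiplicity [m k], whose ranges are orthogonal and exhaust [a].
    Orthogonality for different labels is automatic. *)
Record decomposition a (m : 'I_n.+1 -> nat)
    (e : forall k, 'I_(m k) -> Mor (irr k) a) : Prop := Decomposition {
  dec_ortho : forall k p q, (e k p)^† ∘ e k q = (p == q)%:R *: 1_(irr k);
  dec_full : \sum_k \sum_p e k p ∘ (e k p)^† = 1_a
}.

Lemma dec_cross a m (e : forall k, 'I_(m k) -> Mor (irr k) a) j k p q :
  j <> k -> (e j p)^† ∘ e k q = 0.
Proof. by move=> jk; apply: irr_hom0 => kj; apply: jk. Qed.

(** Orthonormal bases of all the Hom spaces [Mor (irr k) a] decompose [a]: the
    complementary projection [q] kills every morphism from an irreducible, so its
    range has no irreducible subobject and is zero. *)
Lemma seq_decomposition a (s : forall k, seq (Mor (irr k) a)) m :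
    (forall k, size (s k) = m k) ->
    (forall k, orthonormal (s k)) -> (forall k, <<s k>> = fullv)%VS ->
  decomposition (fun k (p : 'I_(m k)) => (s k)`_p).
Proof.
move=> sm; have -> : m = fun k => size (s k) by apply: funext => k; rewrite sm.
move=> os sf; split=> [k p q|]; first by rewrite os.
set e := fun k (p : 'I_(size (s k))) => (s k)`_p.
pose q : Mor a a := 1_a - \sum_k \sum_p e k p ∘ (e k p)^†.
have qe k f : q ∘ (f : Mor (irr k) a) = 0.
  rewrite compDl comp1m compNl comp_suml (bigD1 k) //= [X in - (_ + X)]big1 ?addr0.
    rewrite comp_suml (eq_bigr (fun p => e k p ∘ ((e k p)^† ∘ f))); last first.
      by move=> p _; rewrite compmA.
    by rewrite orthonormal_span ?subrr ?sf ?memvf.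
  move=> j jk; rewrite comp_suml big1 // => p _.
  by rewrite -compmA (@irr_hom0 _ _ ((e j p)^† ∘ f)) ?compm0 // => kj; rewrite kj eqxx in jk.
have qs : q^† = q.
  rewrite /q adjD adjN adj1 adj_sum; congr (_ - _); apply: eq_bigr => k _.
  by rewrite adj_sum; apply: eq_bigr => p _; rewrite adj_comp adjK.
have qq : q ∘ q = q.
  rewrite {2}/q compDr compm1 compNr comp_sumr big1 ?subr0 // => k _.
  by rewrite comp_sumr big1 // => p _; rewrite compmA qe comp0m.
have [b [v [v1 v2]]] := sub qs qq.
have [b0|b0] := pselect (1_b = 0 :> Mor b b).
  by apply/esym/eqP; rewrite -subr_eq0 -/q -v2 -[v]compm1 b0 compm0 comp0m.
have [c [w [ic w1]]] := irreducible_subobject sub b0.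
have [k [u [u1 u2]]] := irrE ic.
have : v ∘ w ∘ u^† = 0.
  rewrite -(qe k (v ∘ w ∘ u^†)) -v2 !compmA.
  by rewrite -(compmA v (v^†)) v1 compm1.
move/(congr1 (fun f => w^† ∘ (v^† ∘ f) ∘ u)); rewrite !(compm0, comp0m) !compmA.
rewrite -(compmA (w^†)) v1 compm1 w1 comp1m u1 => c0.
by case: ic => [].
Qed.

Lemma exists_decomposition a : exists m (e : forall k, 'I_(m k) -> Mor (irr k) a),
  decomposition e.
Proof.
have H k : exists s : seq (Mor (irr k) a), orthonormal s /\ (<<s>> = fullv)%VS.
  case: (orthonormal_basis (irrI k) (fullv : {vspace Mor (irr k) a})) => s [os ss se].
  by exists s; split=> //; apply: (orthonormal_basis_full (irrI k)).
pose s k := sval (cid (H k)).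
have [os sf] : (forall k, orthonormal (s k)) /\ (forall k, <<s k>> = fullv)%VS.
  by split=> k; rewrite /s; case: (cid _) => ? [].
by exists (fun k => size (s k)), (fun k p => (s k)`_p); apply: seq_decomposition.
Qed.

Lemma decomposition_dim a m (e : forall k, 'I_(m k) -> Mor (irr k) a) k :
  decomposition e -> m k = \dim (fullv : {vspace Mor (irr k) a}).
Proof.
move=> de; pose s := mkseq (fun p => oapp (e k) 0 (insub p)) (m k).
have sz : size s = m k by rewrite size_mkseq.
have sE (p : 'I_(m k)) : s`_p = e k p by rewrite nth_mkseq ?ltn_ord // valK.
rewrite -[LHS]sz; apply: (orthonormal_full (irrI k)).
  move=> p q; rewrite sz => pm qm.
  by rewrite -[p]/(val (Ordinal pm)) -[q]/(val (Ordinal qm)) !sE (dec_ortho de).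
apply/eqP; rewrite eqEsubv subvf; apply/subvP => f _; rewrite -[f]comp1m -(dec_full de).
rewrite comp_suml; apply: rpred_sum => j _; rewrite comp_suml; apply: rpred_sum => p _.
rewrite -compmA; have [jk|jk] := pselect (j = k); last first.
  by rewrite (@irr_hom0 _ _ ((e j p)^† ∘ f)) ?compm0 ?rpred0 // => kj; apply: jk.
(* identify the labels [j] and [k], so that [(e j p)^† ∘ f] becomes a scalar *)
case: (irreducible_scalar ((e j p)^† ∘ (ecast j (Mor (irr j) a) (esym jk) f)) (irrI j)).
move: p; case: _ / (esym jk) => p z /= ->; rewrite compZr compm1 rpredZ //.
by rewrite -sE memv_span // mem_nth // sz.
Qed.

(** Two decompositions with the same multiplicities are related by a unitary. *)
Lemma decomposition_unitary a b m (e : forall k, 'I_(m k) -> Mor (irr k) a)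
    (e' : forall k, 'I_(m k) -> Mor (irr k) b) :
    decomposition e -> decomposition e' ->
  exists2 u : Mor a b, unitary u & forall k p, u ∘ e k p = e' k p.
Proof.
have H a0 b0 (f : forall k, 'I_(m k) -> Mor (irr k) a0)
    (g : forall k, 'I_(m k) -> Mor (irr k) b0) : decomposition f -> forall k p,
    (\sum_k \sum_p g k p ∘ (f k p)^†) ∘ f k p = g k p.
  move=> df k p; rewrite comp_suml (bigD1 k) //= [X in _ + X]big1 ?addr0.
    rewrite comp_suml (bigD1 p) //= [X in _ + X]big1 ?addr0.
      by rewrite -compmA (dec_ortho df) eqxx scale1r compm1.
    by move=> q qp; rewrite -compmA (dec_ortho df) (negbTE qp) scale0r compm0.
  move=> j jk; rewrite comp_suml big1 // => q _.
  by rewrite -compmA dec_cross ?compm0 //; apply/eqP.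
have A a0 b0 (f : forall k, 'I_(m k) -> Mor (irr k) a0)
    (g : forall k, 'I_(m k) -> Mor (irr k) b0) :
    (\sum_k \sum_p g k p ∘ (f k p)^†)^† = \sum_k \sum_p f k p ∘ (g k p)^†.
  rewrite adj_sum; apply: eq_bigr => k _; rewrite adj_sum; apply: eq_bigr => p _.
  by rewrite adj_comp adjK.
move=> de de'; exists (\sum_k \sum_p e' k p ∘ (e k p)^†); last exact: H.
split; rewrite A.
  rewrite -(dec_full de) comp_sumr; apply: eq_bigr => k _; rewrite comp_sumr.
  by apply: eq_bigr => p _; rewrite compmA H.
rewrite -(dec_full de') comp_sumr; apply: eq_bigr => k _; rewrite comp_sumr.
by apply: eq_bigr => p _; rewrite compmA H.
Qed.

Lemma dec_separate a b m (e : forall k, 'I_(m k) -> Mor (irr k) a)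
    (f g : Mor a b) : decomposition e ->
  (forall k p, f ∘ e k p = g ∘ e k p) -> f = g.
Proof.
move=> de h; rewrite -[f]compm1 -[g]compm1 -(dec_full de) !comp_sumr.
apply: eq_bigr => k _; rewrite !comp_sumr; apply: eq_bigr => p _.
by rewrite !compmA h.
Qed.

End Bases.

(** * Diagonalising a unitary whose square is scalar *)

Section Eigenbases.
Context {R : realType} {C : cstar_category R}.

(** The eigenspaces of a unitary on [Mor k a] with eigenvalues [μ] and [- μ] are
    orthogonal, and they span when its square is the scalar [μ ^+ 2]. *)
Lemma eigenbasis (k a : Ob C) (c : Mor a a) (μ : R[i]) :
    irreducible k -> unitary c -> μ != 0 ->
    (forall f : Mor k a, c ∘ (c ∘ f) = μ ^+ 2 *: f) ->
  exists s1 s2 : seq (Mor k a),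
  [/\ orthonormal (s1 ++ s2), (<<s1 ++ s2>> = fullv)%VS,
      forall f, f \in s1 -> c ∘ f = μ *: f
    & forall f, f \in s2 -> c ∘ f = (- μ) *: f].
Proof.
move=> ik [uc _] m0 cc.
have lin w : linear (fun f : Mor k a => c ∘ f - w *: f).
  move=> z f g; rewrite comp_linearr !scalerDr opprD addrACA; congr (_ + _).
  by rewrite scalerN !scalerA mulrC.
pose F w : {linear Mor k a -> Mor k a} :=
  HB.pack (fun f : Mor k a => c ∘ f - w *: f) (GRing.isLinear.Build _ _ _ _ _ (lin w)).
pose W w : {vspace Mor k a} := lker (linfun (F w)).
have WP w f : f \in W w -> c ∘ f = w *: f.
  by rewrite memv_ker lfunE /= subr_eq0 => /eqP.
have PW w f : c ∘ f = w *: f -> f \in W w.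
  by move=> e; rewrite memv_ker lfunE /= e subrr.
have [s1 [o1 w1 d1]] := orthonormal_basis ik (W μ).
have [s2 [o2 w2 d2]] := orthonormal_basis ik (W (- μ)).
have ort f g : f \in W μ -> g \in W (- μ) -> g^† ∘ f = 0.
  (* inserting [c^† ∘ c] multiplies the inner product by [- `|μ| ^+ 2] *)
  move=> /WP ef /WP eg; have : g^† ∘ (c^† ∘ c) ∘ f = g^† ∘ f by rewrite uc compm1.
  rewrite compmA -adj_comp -compmA ef eg adjZ compZl compZr scalerA => /eqP.
  rewrite -subr_eq0 -{2}[g^† ∘ f]scale1r -scalerBl scaler_eq0 => /orP [|/eqP //].
  rewrite rmorphN mulNr -opprD oppr_eq0 mulrC -normCK paddr_eq0 ?exprn_ge0 //.
  by rewrite oner_eq0 andbF.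
exists s1, s2; split.
- move=> p q; rewrite !size_cat !nth_cat => ps qs.
  case: ltnP => p1; case: ltnP => q1.
  + exact: o1.
  + rewrite -[LHS]adjK adj_comp adjK ort ?adj0; first 1 last.
    * by apply: w1; apply: mem_nth.
    * by apply: w2; apply: mem_nth; rewrite ltn_subLR.
    by rewrite (ltn_eqF (leq_trans p1 q1)) scale0r.
  + rewrite ort; first 1 last.
    * by apply: w1; apply: mem_nth.
    * by apply: w2; apply: mem_nth; rewrite ltn_subLR.
    by rewrite (gtn_eqF (leq_trans q1 p1)) scale0r.
  + rewrite o2 ?ltn_subLR // eqn_sub2rE //.
- apply/eqP; rewrite eqEsubv subvf; apply/subvP => f _.
  rewrite span_cat (orthonormal_basis_full ik o1 w1 d1) (orthonormal_basis_full ik o2 w2 d2).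
  have -> : f = 2^-1 *: (f + μ^-1 *: (c ∘ f)) + 2^-1 *: (f - μ^-1 *: (c ∘ f)).
    have f2 : f + f = 2 *: f by rewrite scaler_nat mulr2n.
    by rewrite -scalerDr addrACA subrr addr0 f2 scalerA mulVf ?scale1r ?pnatr_eq0.
  apply: memv_add; apply: rpredZ; apply: PW.
    rewrite compDr compZr cc scalerDr !scalerA expr2 mulKf // mulfV // scale1r.
    by rewrite addrC.
  rewrite compDr compNr compZr cc scaleNr scalerBr !scalerA expr2 mulKf // mulfV // scale1r.
  by rewrite opprB.
- by move=> f /w1 /WP.
- by move=> f /w2 /WP.
Qed.

Variables (n : nat) (irr : 'I_n.+1 -> Ob C).
Hypothesis irrI : forall i, irreducible (irr i).
Hypothesis irrN : forall i j, unitarily_iso (irr i) (irr j) -> i = j.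
Hypothesis irrE : forall a, irreducible a -> exists i, unitarily_iso a (irr i).
Hypothesis sub : has_subobjects C.

(** A unitary endomorphism whose square is scalar on every isotypic component
    is diagonal in some decomposition, the eigenvalues [μ k] coming before the
    [- μ k]; [np k] is the number of the former. *)
Lemma eigen_decomposition (a : Ob C) (c : Mor a a) (μ : 'I_n.+1 -> R[i]) :
    unitary c -> (forall k, μ k != 0) ->
    (forall k (f : Mor (irr k) a), c ∘ (c ∘ f) = μ k ^+ 2 *: f) ->
  exists (np : 'I_n.+1 -> nat)
    (e : forall k, 'I_(\dim (fullv : {vspace Mor (irr k) a})) -> Mor (irr k) a),
  [/\ decomposition e,
      forall k, (np k <= \dim (fullv : {vspace Mor (irr k) a}))%N
    & forall k p, c ∘ e k p = (if (p < np k)%N then μ k else - μ k) *: e k p].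
Proof.
move=> uc m0 cc.
have H : forall k, exists s : seq (Mor (irr k) a) * seq (Mor (irr k) a),
  [/\ orthonormal (s.1 ++ s.2), (<<s.1 ++ s.2>> = fullv)%VS,
      forall f, f \in s.1 -> c ∘ f = μ k *: f
    & forall f, f \in s.2 -> c ∘ f = (- μ k) *: f].
  move=> k; have [s1 [s2 h]] := eigenbasis (irrI k) uc (m0 k) (cc k).
  by exists (s1, s2).
pose s k := sval (cid (H k)).
have hs k : [/\ orthonormal ((s k).1 ++ (s k).2), (<<(s k).1 ++ (s k).2>> = fullv)%VS,
    forall f, f \in (s k).1 -> c ∘ f = μ k *: f
  & forall f, f \in (s k).2 -> c ∘ f = (- μ k) *: f] by exact: svalP (cid (H k)).
have sz k : size ((s k).1 ++ (s k).2) = \dim (fullv : {vspace Mor (irr k) a}).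
  by case: (hs k) => o f _ _; apply: (orthonormal_full (irrI k)).
exists (fun k => size (s k).1), (fun k p => ((s k).1 ++ (s k).2)`_p); split.
- by apply: (seq_decomposition irrI irrN irrE sub) => // k; case: (hs k).
- by move=> k; rewrite -sz size_cat leq_addr.
- move=> k p; rewrite nth_cat; case: (hs k) => _ _ h1 h2.
  case: ltnP => hp; [apply: h1|apply: h2]; apply: mem_nth => //.
  by rewrite ltn_subLR // -size_cat sz.
Qed.
End Eigenbases.

(** * Linearity and coherence of the tensor product *)

Section TensorLinear.
Context {R : realType} {C : cstar_category R} (T : tensor_data C).
Implicit Types a b c x y : Ob C.
Local Notation "a ⊗ b" := (tob T a b) (at level 39, left associativity).
Local Notation "f ⊠ g" := (thom T f g) (at level 39, left associativity).

Lemma thom0l a b c d (g : Mor c d) : (0 : Mor a b) ⊠ g = 0.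
Proof.
apply: (addIr (0 ⊠ g)); rewrite add0r -[X in X + _]scale1r.
by rewrite -thom_linearl scale1r addr0.
Qed.

Lemma thom0r a b c d (f : Mor a b) : f ⊠ (0 : Mor c d) = 0.
Proof.
apply: (addIr (f ⊠ 0)); rewrite add0r -[X in X + _]scale1r.
by rewrite -thom_linearr scale1r addr0.
Qed.

Lemma thomDl a b c d (f f' : Mor a b) (g : Mor c d) :
  (f + f') ⊠ g = f ⊠ g + f' ⊠ g.
Proof. by rewrite -[f]scale1r thom_linearl !scale1r. Qed.

Lemma thomDr a b c d (f : Mor a b) (g g' : Mor c d) :
  f ⊠ (g + g') = f ⊠ g + f ⊠ g'.
Proof. by rewrite -[g]scale1r thom_linearr !scale1r. Qed.

Lemma thomZl a b c d z (f : Mor a b) (g : Mor c d) :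
  (z *: f) ⊠ g = z *: (f ⊠ g).
Proof. by rewrite -[z *: f]addr0 thom_linearl thom0l addr0. Qed.

Lemma thomZr a b c d z (f : Mor a b) (g : Mor c d) :
  f ⊠ (z *: g) = z *: (f ⊠ g).
Proof. by rewrite -[z *: g]addr0 thom_linearr thom0r addr0. Qed.

Lemma thom_suml a b c d J (s : seq J) (P : pred J) (F : J -> Mor a b)
    (g : Mor c d) :
  (\sum_(j <- s | P j) F j) ⊠ g = \sum_(j <- s | P j) (F j ⊠ g).
Proof.
by apply: (big_morph (fun f => f ⊠ g)) => [f f'|]; rewrite ?thomDl ?thom0l.
Qed.

Lemma thom_sumr a b c d J (s : seq J) (P : pred J) (F : J -> Mor c d)
    (f : Mor a b) :
  f ⊠ (\sum_(j <- s | P j) F j) = \sum_(j <- s | P j) (f ⊠ F j).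
Proof.
by apply: (big_morph (fun g => f ⊠ g)) => [g g'|]; rewrite ?thomDr ?thom0r.
Qed.

Lemma thom_unitary a b c d (u : Mor a b) (v : Mor c d) :
  unitary u -> unitary v -> unitary (u ⊠ v).
Proof.
by move=> [u1 u2] [v1 v2]; split; rewrite thom_adj -thom_comp ?u1 ?v1 ?u2 ?v2 thom1.
Qed.

(** The two orders in which a tensor product of morphisms can be composed. *)
Lemma thom_split a b c d (f : Mor a b) (g : Mor c d) :
  f ⊠ g = (f ⊠ 1_d) ∘ (1_a ⊠ g).
Proof. by rewrite -thom_comp compm1 comp1m. Qed.

Lemma thom_split' a b c d (f : Mor a b) (g : Mor c d) :
  f ⊠ g = (1_b ⊠ g) ∘ (f ⊠ 1_c).
Proof. by rewrite -thom_comp compm1 comp1m. Qed.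

Lemma thom_swap a b c d (f : Mor a b) (g : Mor c d) :
  (f ⊠ 1_d) ∘ (1_a ⊠ g) = (1_b ⊠ g) ∘ (f ⊠ 1_c).
Proof. by rewrite -thom_split thom_split'. Qed.

Lemma thom1M a b c d (f : Mor b c) (g : Mor a b) :
  1_d ⊠ (f ∘ g) = (1_d ⊠ f) ∘ (1_d ⊠ g).
Proof. by rewrite -thom_comp comp1m. Qed.

Lemma thomM1 a b c d (f : Mor b c) (g : Mor a b) :
  (f ∘ g) ⊠ 1_d = (f ⊠ 1_d) ∘ (g ⊠ 1_d).
Proof. by rewrite -thom_comp comp1m. Qed.

Lemma lunit_inj a b (f g : Mor a b) : 1_(tunit T) ⊠ f = 1_(tunit T) ⊠ g -> f = g.
Proof.
move=> e; apply: (unitary_rcan (lunit_unitary T a)).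
by rewrite !lunit_natural e.
Qed.

Lemma runit_inj a b (f g : Mor a b) : f ⊠ 1_(tunit T) = g ⊠ 1_(tunit T) -> f = g.
Proof.
move=> e; apply: (unitary_rcan (runit_unitary T a)).
by rewrite !runit_natural e.
Qed.

End TensorLinear.

Section Coherence.
Context {R : realType} {C : cstar_category R} (T : tensor_data C).
Implicit Types a b c x y : Ob C.
Local Notation "a ⊗ b" := (tob T a b) (at level 39, left associativity).
Local Notation "f ⊠ g" := (thom T f g) (at level 39, left associativity).
Local Notation I := (tunit T).
Local Notation λ := (lunit T).
Local Notation ρ := (runit T).
Variables (α : associator_family T) (Hα : unitary_associator α).

Lemma assocK a b c : (α a b c)^† ∘ α a b c = 1_(a ⊗ b ⊗ c).
Proof. by case: (assoc_unitary Hα a b c). Qed.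

Lemma assocKV a b c : α a b c ∘ (α a b c)^† = 1_(a ⊗ (b ⊗ c)).
Proof. by case: (assoc_unitary Hα a b c). Qed.

(** The next four lemmas are Kelly's consequences of the pentagon and triangle
    equations. *)
Lemma lunit_tensor a b : λ (a ⊗ b) ∘ α I a b = λ a ⊠ 1_b.
Proof.
apply: (@lunit_inj _ _ T); apply: (@unitary_rcan _ _ _ _ _ (α I (I ⊗ a) b ∘ (α I I a ⊠ 1_b))).
  by apply: unitaryM; last apply: thom_unitary; try exact: assoc_unitary; apply: unitary1.
rewrite thom1M -compmA [X in _ ∘ X = _]compmA -(assoc_pentagon Hα) compmA.
rewrite (assoc_triangle Hα) -{1}(thom1 T a b) -(assoc_natural Hα).
rewrite [RHS]compmA -(assoc_natural Hα) -compmA -thom_comp comp1m.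
by rewrite (assoc_triangle Hα).
Qed.

Lemma runit_tensor a b : (1_a ⊠ ρ b) ∘ α a b I = ρ (a ⊗ b).
Proof.
apply: (@runit_inj _ _ T).
apply: (@unitary_lcan _ _ _ _ _ (α a b I)); first exact: assoc_unitary.
rewrite thomM1 compmA (assoc_natural Hα) -(assoc_triangle Hα b I) thom1M.
rewrite -2!compmA [X in _ ∘ X = _]compmA -(assoc_pentagon Hα) compmA -(assoc_natural Hα).
by rewrite thom1 -compmA (assoc_triangle Hα).
Qed.

Lemma lunitI : λ (I ⊗ I) = 1_I ⊠ λ I.
Proof.
apply: (@unitary_lcan _ _ _ _ _ (λ I)); first exact: lunit_unitary.
by rewrite lunit_natural.
Qed.

Lemma lunit_runit : λ I = ρ I.
Proof.
apply: (@runit_inj _ _ T).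
by rewrite -lunit_tensor lunitI (assoc_triangle Hα).
Qed.

End Coherence.

(** * Module functors and their two-cells *)

Section ModuleFunctors.
Context {R : realType} {C : cstar_category R} (T : tensor_data C).
Implicit Types a b c x y : Ob C.
Local Notation "a ⊗ b" := (tob T a b) (at level 39, left associativity).
Local Notation "f ⊠ g" := (thom T f g) (at level 39, left associativity).
Local Notation I := (tunit T).

(** A right module endofunctor of [C]: a linear functor [fo], [fm] compatible
    with adjoints, with a unitary comparison [stg] from [F x ⊗ y] to
    [F (x ⊗ y)]. Naturality in the first variable is the only property of the
    comparison which is recorded. *)
Record mfun : Type := MFun {
  fo :> Ob C -> Ob C;
  fm : forall x y, Mor x y -> Mor (fo x) (fo y);
  stg : forall x y, Mor (fo x ⊗ y) (fo (x ⊗ y));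
  fm1 : forall x, fm (1_x) = 1_(fo x);
  fmM : forall x y z (g : Mor y z) (f : Mor x y), fm (g ∘ f) = fm g ∘ fm f;
  fm_lin : forall x y z (f g : Mor x y), fm (z *: f + g) = z *: fm f + fm g;
  fm_adj : forall x y (f : Mor x y), fm (f^†) = (fm f)^†;
  stg_unitary : forall x y, unitary (stg x y);
  stg_nat : forall x x' y (f : Mor x x'),
    fm (f ⊠ 1_y) ∘ stg x y = stg x' y ∘ (fm f ⊠ 1_y)
}.
Arguments fm F {x y} f : rename.
Arguments stg F x y : rename.
Local Notation "F ▹ f" := (fm F f) (at level 37, right associativity).

Implicit Types F G H K : mfun.

Lemma fm0 F x y : F ▹ (0 : Mor x y) = 0.
Proof.
apply: (addIr (F ▹ 0)); rewrite add0r -[X in X + _]scale1r.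
by rewrite -fm_lin scale1r addr0.
Qed.

Lemma fmD F x y (f g : Mor x y) : F ▹ (f + g) = F ▹ f + F ▹ g.
Proof. by rewrite -[f]scale1r fm_lin !scale1r. Qed.

Lemma fmZ F x y z (f : Mor x y) : F ▹ (z *: f) = z *: (F ▹ f).
Proof. by rewrite -[z *: f]addr0 fm_lin fm0 addr0. Qed.

Lemma fm_sum F x y J (s : seq J) (P : pred J) (f : J -> Mor x y) :
  F ▹ (\sum_(j <- s | P j) f j) = \sum_(j <- s | P j) F ▹ f j.
Proof. by apply: (big_morph (fm F)) => [g h|]; rewrite ?fmD ?fm0. Qed.

Lemma fm_unitary F x y (u : Mor x y) : unitary u -> unitary (F ▹ u).
Proof. by case=> u1 u2; split; rewrite -fm_adj -fmM ?u1 ?u2 fm1. Qed.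

#[local] Obligation Tactic := idtac.
(** The identity module functor. *)
Program Definition idf : mfun :=
  @MFun (fun x => x) (fun x y f => f) (fun x y => 1_(x ⊗ y)) _ _ _ _ _ _.
Next Obligation. by []. Qed.
Next Obligation. by []. Qed.
Next Obligation. by []. Qed.
Next Obligation. by []. Qed.
Next Obligation. by move=> *; apply: unitary1. Qed.
Next Obligation. by move=> *; rewrite compm1 comp1m. Qed.

(** Composition of module functors. On objects and morphisms it is associative
    and unital by conversion, so that a string of functors applied to an object
    needs no bracketing. *)
Program Definition fcomp F G : mfun :=
  @MFun (fun x => F (G x)) (fun x y f => F ▹ (G ▹ f))
    (fun x y => F ▹ stg G x y ∘ stg F (G x) y) _ _ _ _ _ _.
Next Obligation. by move=> F G x /=; rewrite !fm1. Qed.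
Next Obligation. by move=> F G x y z g f /=; rewrite !fmM. Qed.
Next Obligation. by move=> F G x y z f g /=; rewrite !fm_lin. Qed.
Next Obligation. by move=> F G x y f /=; rewrite !fm_adj. Qed.
Next Obligation.
by move=> F G x y; apply: unitaryM; [apply: fm_unitary|]; apply: stg_unitary.
Qed.
Next Obligation.
move=> F G x x' y f; rewrite compmA -fmM stg_nat fmM -compmA stg_nat.
by rewrite compmA.
Qed.
Local Notation "F ⊙ G" := (fcomp F G) (at level 38, right associativity).

(** Two-cells between module functors: natural families compatible with the
    comparisons. *)
Record iscell F G (φ : forall x, Mor (F x) (G x)) : Prop := IsCell {
  cnat : forall x y (f : Mor x y), φ y ∘ F ▹ f = G ▹ f ∘ φ x;
  cmod : forall x y, φ (x ⊗ y) ∘ stg F x y = stg G x y ∘ (φ x ⊠ 1_y)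
}.

Lemma cell_ext F G (φ ψ : forall x, Mor (F x) (G x)) :
  (forall x, φ x = ψ x) -> iscell ψ -> iscell φ.
Proof. by move=> e [n m]; split=> [x y f|x y]; rewrite !e. Qed.

Lemma cell1 F : iscell (fun x => 1_(F x)).
Proof. by split=> *; rewrite ?thom1 comp1m compm1. Qed.

Lemma cellM F G H (φ : forall x, Mor (G x) (H x)) (ψ : forall x, Mor (F x) (G x)) :
  iscell φ -> iscell ψ -> iscell (fun x => φ x ∘ ψ x).
Proof.
move=> [n1 m1] [n2 m2]; split=> [x y f|x y].
  by rewrite -compmA n2 compmA n1 compmA.
by rewrite -compmA m2 compmA m1 -compmA -thom_comp comp1m.
Qed.

Lemma cell_adj F G (φ : forall x, Mor (F x) (G x)) :
  iscell φ -> iscell (fun x => (φ x)^†).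
Proof.
move=> [n m]; split=> [x y f|x y].
  by apply: adj_eq; rewrite !adj_comp !adjK -!fm_adj n.
apply: adj_eq; apply: (unitary_lcan (stg_unitary G x y)).
apply: (unitary_rcan (stg_unitary F x y)).
rewrite !adj_comp thom_adj !adjK adj1.
have [_ sG] := stg_unitary G x y; have [sF _] := stg_unitary F x y.
by rewrite compmA sG comp1m m compmA -compmA sF compm1.
Qed.

(** Whiskering on the left, then on the right. *)
Lemma cell_whl H F G (φ : forall x, Mor (F x) (G x)) :
  iscell φ -> @iscell (H ⊙ F) (H ⊙ G) (fun x => H ▹ φ x).
Proof.
move=> [n m]; split=> [x y f|x y] /=; first by rewrite -!fmM n.
by rewrite compmA -fmM m fmM -!compmA stg_nat.
Qed.

Lemma cell_whr H F G (φ : forall x, Mor (F x) (G x)) :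
  iscell φ -> @iscell (F ⊙ H) (G ⊙ H) (fun x => φ (H x)).
Proof.
move=> [n m]; split=> [x y f|x y] /=; first by rewrite n.
by rewrite compmA n -compmA m compmA.
Qed.

(** The comparisons of the two bracketings of a composite of functors are equal
    but not convertible; the lemmas below move a two-cell between bracketings of
    its source or of its target. *)
Lemma stg_assoc F G H x y : stg ((F ⊙ G) ⊙ H) x y = stg (F ⊙ (G ⊙ H)) x y.
Proof. by rewrite /= fmM compmA. Qed.

Lemma stg_idl F x y : stg (idf ⊙ F) x y = stg F x y.
Proof. by rewrite /= compm1. Qed.

Lemma stg_idr F x y : stg (F ⊙ idf) x y = stg F x y.
Proof. by rewrite /= fm1 comp1m. Qed.

Lemma cell_asrcr F G H K φ : @iscell ((F ⊙ G) ⊙ H) K φ -> @iscell (F ⊙ (G ⊙ H)) K φ.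
Proof.
by case=> n m; split=> [x y f|x y]; [apply: n | rewrite -(stg_assoc F G H); exact (m x y)].
Qed.

Lemma cell_atgtl F G H K φ : @iscell K (F ⊙ (G ⊙ H)) φ -> @iscell K ((F ⊙ G) ⊙ H) φ.
Proof.
by case=> n m; split=> [x y f|x y]; [apply: n | rewrite (stg_assoc F G H); exact (m x y)].
Qed.

Lemma cell_atgtr F G H K φ : @iscell K ((F ⊙ G) ⊙ H) φ -> @iscell K (F ⊙ (G ⊙ H)) φ.
Proof.
by case=> n m; split=> [x y f|x y]; [apply: n | rewrite -(stg_assoc F G H); exact (m x y)].
Qed.

Lemma cell_isrcl F K φ : @iscell (idf ⊙ F) K φ -> @iscell F K φ.
Proof.
by case=> n m; split=> [x y f|x y]; [apply: n | rewrite -(stg_idl F); exact (m x y)].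
Qed.

Lemma cell_isrcr F K φ : @iscell (F ⊙ idf) K φ -> @iscell F K φ.
Proof.
by case=> n m; split=> [x y f|x y]; [apply: n | rewrite -(stg_idr F); exact (m x y)].
Qed.

Lemma cell_itgtl F K φ : @iscell K (idf ⊙ F) φ -> @iscell K F φ.
Proof.
by case=> n m; split=> [x y f|x y]; [apply: n | rewrite -(stg_idl F); exact (m x y)].
Qed.

Lemma cell_itgtr F K φ : @iscell K (F ⊙ idf) φ -> @iscell K F φ.
Proof.
by case=> n m; split=> [x y f|x y]; [apply: n | rewrite -(stg_idr F); exact (m x y)].
Qed.

End ModuleFunctors.

Notation "F ▹ f" := (fm F f) (at level 37, right associativity) : cat_scope.
Notation "F ⊙ G" := (fcomp F G) (at level 38, right associativity) : cat_scope.
Arguments fm {R C T} F {x y} f : rename.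
Arguments stg {R C T} F x y : rename.
Arguments iscell {R C T} F G φ.
Arguments idf {R C T}.

(** * Duality and partial traces *)

Section Duality.
Context {R : realType} {C : cstar_category R} {T : tensor_data C}.
Implicit Types a b c x y : Ob C.
Implicit Types F G H K : mfun T.

(** Two-sided duals of module functors: [dr] and [ds] solve the conjugate
    equations [zig] and [zag], and by [sphl] and [sphr] the left and the right
    traces agree on endomorphisms of [F] and of [G]. This is the property of
    standard solutions which is stable under composition. *)
Record dual F G : Type := Dual {
  dr : forall x, Mor x (G (F x));
  ds : forall x, Mor x (F (G x));
  dr_cell : iscell idf (G ⊙ F) dr;
  ds_cell : iscell idf (F ⊙ G) ds;
  zig : forall x, (ds (F x))^† ∘ F ▹ dr x = 1_(F x);
  zag : forall x, (dr (G x))^† ∘ G ▹ ds x = 1_(G x);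
  sphl : forall φ : forall x, Mor (F x) (F x), iscell F F φ ->
    forall x, (dr x)^† ∘ G ▹ φ x ∘ dr x = (ds x)^† ∘ φ (G x) ∘ ds x;
  sphr : forall φ : forall x, Mor (G x) (G x), iscell G G φ ->
    forall x, (ds x)^† ∘ F ▹ φ x ∘ ds x = (dr x)^† ∘ φ (F x) ∘ dr x
}.

Definition dual_swap F G (D : dual F G) : dual G F :=
  @Dual G F (ds D) (dr D) (ds_cell D) (dr_cell D) (zag D) (zig D) (sphr D) (sphl D).

Lemma dr_nat F G (D : dual F G) x y (f : Mor x y) :
  dr D y ∘ f = G ▹ F ▹ f ∘ dr D x.
Proof. exact: (cnat (dr_cell D)). Qed.

Lemma ds_nat F G (D : dual F G) x y (f : Mor x y) :
  ds D y ∘ f = F ▹ G ▹ f ∘ ds D x.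
Proof. exact: (cnat (ds_cell D)). Qed.

Lemma dr_natV F G (D : dual F G) x y (f : Mor x y) :
  (dr D y)^† ∘ G ▹ F ▹ f = f ∘ (dr D x)^†.
Proof. by apply: adj_eq; rewrite !adj_comp !adjK -!fm_adj dr_nat. Qed.

Lemma ds_natV F G (D : dual F G) x y (f : Mor x y) :
  (ds D y)^† ∘ F ▹ G ▹ f = f ∘ (ds D x)^†.
Proof. by apply: adj_eq; rewrite !adj_comp !adjK -!fm_adj ds_nat. Qed.

Lemma zigV F G (D : dual F G) x : F ▹ (dr D x)^† ∘ ds D (F x) = 1_(F x).
Proof. by apply: adj_eq; rewrite adj_comp -fm_adj adjK zig adj1. Qed.

Lemma zagV F G (D : dual F G) x : G ▹ (ds D x)^† ∘ dr D (G x) = 1_(G x).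
Proof. by apply: adj_eq; rewrite adj_comp -fm_adj adjK zag adj1. Qed.

(** The partial left trace over [F]. Like the composites defined below it is
    locked, so that rewriting with associativity does not look inside. *)
Definition ptr F G (D : dual F G) x y (h : Mor (F x) (F y)) : Mor x y :=
  locked ((dr D y)^† ∘ G ▹ h ∘ dr D x).

Lemma ptrE F G (D : dual F G) x y (h : Mor (F x) (F y)) :
  ptr D h = (dr D y)^† ∘ G ▹ h ∘ dr D x.
Proof. by rewrite /ptr -lock. Qed.

Lemma ptrMr F G (D : dual F G) x y z (h : Mor (F y) (F z)) (f : Mor x y) :
  ptr D (h ∘ F ▹ f) = ptr D h ∘ f.
Proof. by rewrite !ptrE fmM compmA -[LHS]compmA -dr_nat compmA. Qed.

Lemma ptrMl F G (D : dual F G) x y z (h : Mor (F x) (F y)) (f : Mor y z) :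
  ptr D (F ▹ f ∘ h) = f ∘ ptr D h.
Proof. by rewrite !ptrE fmM compmA dr_natV -!compmA. Qed.

Lemma ptrZ F G (D : dual F G) x y z (h : Mor (F x) (F y)) :
  ptr D (z *: h) = z *: ptr D h.
Proof. by rewrite !ptrE fmZ compZr compZl. Qed.

Lemma ptr_sum F G (D : dual F G) x y J (s : seq J) (P : pred J)
    (h : J -> Mor (F x) (F y)) :
  ptr D (\sum_(j <- s | P j) h j) = \sum_(j <- s | P j) ptr D (h j).
Proof.
rewrite ptrE fm_sum comp_sumr comp_suml.
by apply: eq_bigr => j _; rewrite ptrE.
Qed.

(** The three lemmas [comp_cell], [comp_zig] and [comp_sph] show that duals
    compose. *)
Lemma comp_cell (F F' G G' : mfun T) (D : dual F F') (E : dual G G') :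
  iscell idf ((G' ⊙ F') ⊙ (F ⊙ G)) (fun x => G' ▹ dr D (G x) ∘ dr E x).
Proof.
apply: cell_atgtl; apply: cellM (dr_cell E); apply: cell_whl.
by apply: cell_atgtr; apply: cell_isrcl; apply: cell_whr; apply: dr_cell.
Qed.

Lemma comp_zig (F F' G G' : mfun T) (D : dual F F') (E : dual G G') x :
  (F ▹ ds E (F' (F (G x))) ∘ ds D (F (G x)))^† ∘
    F ▹ G ▹ (G' ▹ dr D (G x) ∘ dr E x) = 1_(F (G x)).
Proof.
rewrite adj_comp -fm_adj -compmA -fmM (fmM G) compmA ds_natV.
by rewrite -compmA zig compm1 zig.
Qed.

Lemma comp_sph (F F' G G' : mfun T) (D : dual F F') (E : dual G G')
    (φ : forall x, Mor (F (G x)) (F (G x))) : iscell (F ⊙ G) (F ⊙ G) φ ->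
  forall x, ptr E (ptr D (φ x)) =
    (F ▹ ds E (F' x) ∘ ds D x)^† ∘ φ (G' (F' x)) ∘ (F ▹ ds E (F' x) ∘ ds D x).
Proof.
move=> cφ x.
have c1 : iscell G G (fun x => ptr D (φ x)).
  apply: (cell_ext (fun x => ptrE D (φ x))); apply: (@cellM _ _ _ _ (F' ⊙ (F ⊙ G))).
    apply: (@cellM _ _ _ _ (F' ⊙ (F ⊙ G))); last exact: cell_whl.
    apply: cell_asrcr; apply: cell_itgtl.
    exact: (cell_whr G (cell_adj (dr_cell D))).
  apply: cell_atgtr; apply: cell_isrcl.
  exact: (cell_whr G (dr_cell D)).
(* move the loop of [G] to the right, then that of [F] *)
rewrite [LHS]ptrE (sphl E c1).
rewrite -compmA -(ptrMr D) -(ptrMl D) [LHS]ptrE.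
have c2 : iscell F F (fun x => F ▹ (ds E x)^† ∘ (φ (G' x) ∘ F ▹ ds E x)).
  apply: (@cellM _ _ _ _ (F ⊙ (G ⊙ G'))).
    apply: cell_itgtr; exact: (cell_whl F (cell_adj (ds_cell E))).
  apply: (@cellM _ _ _ _ (F ⊙ (G ⊙ G'))).
    apply: cell_atgtr; apply: cell_asrcr.
    exact: (cell_whr G' cφ).
  apply: cell_isrcr; exact: (cell_whl F (ds_cell E)).
by rewrite (sphl D c2) adj_comp -fm_adj !compmA.
Qed.

(** The dual of a composite. *)
Definition dual_comp F F' G G' (D : dual F F') (E : dual G G') :
  dual (F ⊙ G) (G' ⊙ F').
Proof.
apply: (@Dual (F ⊙ G) (G' ⊙ F') (fun x => G' ▹ dr D (G x) ∘ dr E x)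
  (fun x => F ▹ ds E (F' x) ∘ ds D x)).
- exact: comp_cell.
- exact: (comp_cell (dual_swap E) (dual_swap D)).
- exact: comp_zig.
- exact: (comp_zig (dual_swap E) (dual_swap D)).
- move=> φ cφ x; rewrite -(comp_sph D E cφ) !ptrE /= adj_comp -fm_adj.
  by rewrite !fmM !compmA.
- move=> φ cφ x; rewrite -(comp_sph (dual_swap E) (dual_swap D) cφ) !ptrE /=.
  by rewrite adj_comp -fm_adj !fmM !compmA.
Defined.

Lemma ptr_comp F F' G G' (D : dual F F') (E : dual G G') x y
    (h : Mor (F (G x)) (F (G y))) :
  ptr (dual_comp D E) h = ptr E (ptr D h).
Proof. by rewrite !ptrE /= adj_comp -fm_adj !fmM !compmA. Qed.

Section Trace.
Hypothesis I_irr : irreducible (tunit T).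

(** The module condition at the unit object propagates the scalar to all objects. *)
Lemma cell_scalar (φ : forall x, Mor x x) : iscell (@idf _ _ T) idf φ ->
  exists z, forall x, φ x = z *: 1_x.
Proof.
move=> [n m]; case: (irreducible_scalar (φ (tunit T)) I_irr) => z e; exists z => x.
have := m (tunit T) x; rewrite /= e compm1 comp1m thomZl thom1 => ez.
apply: (unitary_rcan (lunit_unitary T x)).
by have /= -> := n _ _ (lunit T x); rewrite ez compZr compZl comp1m compm1.
Qed.

Variables (F F' K K' : mfun T) (D : dual F F') (E : dual K K').
Variables (v : forall x, Mor (K x) (F x)) (cv : iscell K F v).

(** The transpose of [v] with respect to the two dualities. *)
Lemma transpose_exists : exists w : forall x, Mor (K' x) (F' x),
  [/\ iscell K' F' w,
      forall x, K ▹ w x ∘ ds E x = (v (F' x))^† ∘ ds D x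
    & forall x, (dr D x)^† ∘ w (F x) = (dr E x)^† ∘ K' ▹ (v x)^†].
Proof.
exists (fun x => (dr E (F' x))^† ∘ K' ▹ ((v (F' x))^† ∘ ds D x)); split.
- apply: (@cellM _ _ _ _ (K' ⊙ (K ⊙ F'))).
    apply: cell_asrcr; apply: cell_itgtl; exact: (cell_whr F' (cell_adj (dr_cell E))).
  apply: cell_isrcr; apply: (cell_whl K' (F := idf) (G := K ⊙ F')).
  apply: (@cellM _ _ _ _ (F ⊙ F')); last exact: ds_cell.
  exact: (cell_whr F' (cell_adj cv)).
- by move=> x; rewrite fmM -compmA -ds_nat compmA zigV comp1m.
- move=> x; rewrite compmA -dr_natV -compmA -fmM compmA.
  by rewrite -(cnat (cell_adj cv)) -compmA zigV compm1.
Qed.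

(** The vector [F' ▹ v^† ∘ dr D] is one of the two rotations of [v]; [u] is
    the other one. The two have the same norm, given by the trace of [v ∘ v^†]
    over [F], and their inner product is the trace of [v^† ∘ v] over [K]. *)
Lemma rotate_exists : exists u : forall x, Mor x (F' (K x)),
  [/\ forall x, (u x)^† ∘ u x = ptr D (v x ∘ (v x)^†),
      forall x, (F' ▹ (v x)^† ∘ dr D x)^† ∘ u x = ptr E ((v x)^† ∘ v x)
    & forall x y (h : Mor (F x) (K y)),
        (u y)^† ∘ (F' ▹ h ∘ dr D x) = ptr E (h ∘ v x)].
Proof.
have [w [cw w_ds dr_w]] := transpose_exists; exists (fun x => w (K x) ∘ dr E x).
split=> x.
- have c1 : iscell K' K' (fun x => (w x)^† ∘ w x) by apply: cellM (cell_adj cw) cw.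
  have c2 : iscell F F (fun x => v x ∘ (v x)^†) by apply: cellM cv (cell_adj cv).
  have /= e1 := sphr E c1 x; have /= e2 := sphl D c2 x.
  rewrite adj_comp !compmA -(compmA ((dr E x)^†)) -e1 fmM !compmA.
  by rewrite -compmA w_ds fm_adj -adj_comp w_ds !ptrE e2 adj_comp adjK !compmA.
- rewrite adj_comp -fm_adj adjK compmA -(compmA _ (F' ▹ v x)).
  by rewrite -(cnat cw) compmA dr_w !ptrE fmM !compmA.
- move=> y h; have /= n := cnat (cell_adj cw) h.
  have e : (w (F x))^† ∘ dr D x = K' ▹ v x ∘ dr E x.
    by apply: adj_eq; rewrite !adj_comp adjK dr_w -fm_adj.
  by rewrite adj_comp compmA -(compmA _ _ (F' ▹ h)) n -!compmA e !ptrE fmM !compmA.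
Qed.
End Trace.

Hypothesis I_irr : irreducible (tunit T).

Lemma ptr_scalar F F' (D : dual F F') (φ : forall x, Mor (F x) (F x)) :
  iscell F F φ -> exists z, forall x, ptr D (φ x) = z *: 1_x.
Proof.
move=> cφ; apply: (cell_scalar I_irr).
apply: (@cell_ext _ _ T idf idf _ _ (fun x => ptrE D (φ x))).
apply: (@cellM _ _ _ _ (F' ⊙ F)); last exact: dr_cell.
apply: (@cellM _ _ _ _ (F' ⊙ F)); first exact: (cell_adj (dr_cell D)).
exact: (cell_whl F' cφ).
Qed.

Lemma rotate_diff F F' K K' (D : dual F F') (E : dual K K') v : iscell K F v ->
  exists u : forall x, Mor x (F' (K x)),
    (forall x, (F' ▹ (v x)^† ∘ dr D x - u x)^† ∘ (F' ▹ (v x)^† ∘ dr D x - u x) =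
       2 *: (ptr D (v x ∘ (v x)^†) - ptr E ((v x)^† ∘ v x))) /\
    forall x y (h : Mor (F x) (K y)),
        (u y)^† ∘ (F' ▹ h ∘ dr D x) = ptr E (h ∘ v x).
Proof.
move=> cv; have [u [uu pu hu]] := rotate_exists D E cv; exists u; split=> // x.
rewrite adjD adjN compDl !compDr !compNl !compNr uu pu opprK.
have -> : (u x)^† ∘ (F' ▹ (v x)^† ∘ dr D x) = ptr E ((v x)^† ∘ v x) by rewrite hu.
rewrite (_ : (F' ▹ (v x)^† ∘ dr D x)^† ∘ (F' ▹ (v x)^† ∘ dr D x) = ptr D (v x ∘ (v x)^†)).
  by rewrite scaler_nat mulr2n [- _ + _]addrC.
by rewrite adj_comp -fm_adj adjK !ptrE fmM !compmA.
Qed.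

Lemma ptr_le F F' K K' (D : dual F F') (E : dual K K') v (p q : R[i]) :
    iscell K F v ->
    (forall x, ptr D (v x ∘ (v x)^†) = p *: 1_x) ->
    (forall x, ptr E ((v x)^† ∘ v x) = q *: 1_x) ->
  q <= p.
Proof.
move=> cv ep eq; have [u [uu _]] := rotate_diff D E cv.
have := uu (tunit T); rewrite ep eq -scalerBl scalerA => /(pos_scalar I_irr).
by rewrite pmulr_rge0 ?ltr0n // subr_ge0.
Qed.

(** The trace property. The two rotations of [v] differ by a vector whose
    squared norm is twice the difference of two traces; applied to [v] and to
    [v^†] this gives both inequalities between the traces, so the rotations
    coincide, and the loop of [F] can be slid along [v]. *)
Theorem ptr_cyclic F F' K K' (D : dual F F') (E : dual K K')
    (v : forall x, Mor (K x) (F x)) : iscell K F v ->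
  forall x y (h : Mor (F x) (K y)), ptr D (v y ∘ h) = ptr E (h ∘ v x).
Proof.
move=> cv x y h; have cv' := cell_adj cv.
have [p ep] : exists p, forall x, ptr D (v x ∘ (v x)^†) = p *: 1_x.
  by apply: ptr_scalar; apply: cellM.
have [q eq] : exists q, forall x, ptr E ((v x)^† ∘ v x) = q *: 1_x.
  by apply: ptr_scalar; apply: cellM.
have qp : q <= p by apply: (ptr_le cv ep eq).
have pq : p <= q.
  by apply: (ptr_le (D := E) (E := D) cv') => z; rewrite adjK.
have {qp pq} e : p = q by apply/eqP; rewrite eq_le pq qp.
have [u [uu hu]] := rotate_diff D E cv; rewrite -hu.
have -> : u y = F' ▹ (v y)^† ∘ dr D y.
  apply/esym/eqP; rewrite -subr_eq0; apply/eqP; apply: cstar_eq0.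
  by rewrite uu ep eq e subrr scaler0.
by rewrite adj_comp -fm_adj adjK !ptrE fmM !compmA.
Qed.

End Duality.

(** * The module functors of left tensoring *)

Section LeftTensor.
Context {R : realType} {C : cstar_category R} {T : tensor_data C}.
Implicit Types a b c k l x y : Ob C.
Local Notation "a ⊗ b" := (tob T a b) (at level 39, left associativity).
Local Notation "f ⊠ g" := (thom T f g) (at level 39, left associativity).
Local Notation I := (tunit T).
Local Notation λ := (lunit T).
Local Notation ρ := (runit T).
Variables (α : associator_family T) (Hα : unitary_associator α).

(** The module functor [x |-> a ⊗ x]. *)
Program Definition L a : mfun T :=
  @MFun _ _ T (fun x => a ⊗ x) (fun x y f => 1_a ⊠ f) (fun x y => α a x y)
    _ _ _ _ _ _.
Next Obligation. by rewrite thom1. Qed.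
Next Obligation. by rewrite thom1M. Qed.
Next Obligation. by rewrite thom_linearr. Qed.
Next Obligation. by rewrite thom_adj adj1. Qed.
Next Obligation. exact: assoc_unitary. Qed.
Next Obligation. by rewrite (assoc_natural Hα). Qed.

(** The two-cells given by a morphism, by the associator (this is the pentagon)
    and by the left unit constraint. *)
Lemma cell_hom a b (f : Mor a b) : iscell (L a) (L b) (fun x => f ⊠ 1_x).
Proof.
split=> [x y g|x y] /=; first exact: thom_swap.
by rewrite -(thom1 T x y) (assoc_natural Hα).
Qed.

Lemma cell_assoc a b : iscell (L (a ⊗ b)) (L a ⊙ L b) (fun x => α a b x).
Proof.
split=> [x y f|x y] /=; last exact: assoc_pentagon.
by rewrite -(thom1 T a b) (assoc_natural Hα).
Qed.

Lemma cell_unit : iscell (L I) idf (fun x => λ x).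
Proof.
split=> [x y f|x y] /=; first by rewrite lunit_natural.
by rewrite comp1m lunit_tensor.
Qed.

(** A two-cell of [L a] is determined by its component at the unit object. *)
Lemma L_eq a (φ : forall x, Mor (L a x) (L a x)) z : iscell (L a) (L a) φ ->
  ρ a ∘ φ I ∘ (ρ a)^† = z *: 1_a -> forall x, φ x = z *: 1_(L a x).
Proof.
move=> [n m] e x.
have {}e : φ I = z *: 1_(a ⊗ I).
  apply: (unitary_lcan (runit_unitary T a)).
  apply: (unitary_rcan (unitaryV (runit_unitary T a))); rewrite e.
  by have [_ u] := runit_unitary T a; rewrite compZr compZl compm1 u.
have := m I x; rewrite /= e thomZl thom1 compZr compm1 => ex.
have {}ex : φ (I ⊗ x) = z *: 1_(L a (I ⊗ x)).
  apply: (unitary_rcan (assoc_unitary Hα a I x)).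
  by rewrite ex compZl comp1m.
apply: (unitary_rcan (fm_unitary (L a) (lunit_unitary T x))).
by rewrite n ex compZr compZl comp1m compm1.
Qed.

Lemma L_scalar a (φ : forall x, Mor (L a x) (L a x)) :
    irreducible a -> iscell (L a) (L a) φ ->
  exists z, forall x, φ x = z *: 1_(L a x).
Proof.
move=> ia c; case: (irreducible_scalar (ρ a ∘ φ I ∘ (ρ a)^†) ia) => z e.
by exists z; apply: L_eq.
Qed.

(** The two-cell of a morphism [k -> a ⊗ b]. *)
Definition vcell a b k (f : Mor k (a ⊗ b)) x : Mor (L k x) (L a (L b x)) :=
  locked (α a b x ∘ (f ⊠ 1_x)).

Lemma vcellE a b k (f : Mor k (a ⊗ b)) x : vcell f x = α a b x ∘ (f ⊠ 1_x).
Proof. by rewrite /vcell -lock. Qed.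

Lemma vcell_cell a b k (f : Mor k (a ⊗ b)) :
  iscell (L k) (L a ⊙ L b) (vcell f).
Proof.
apply: cell_ext => [x|]; first exact: vcellE.
exact: cellM (cell_assoc a b) (cell_hom f).
Qed.

Lemma vcell_adjM a b k l (f : Mor k (a ⊗ b)) (g : Mor l (a ⊗ b)) x :
  (vcell f x)^† ∘ vcell g x = (f^† ∘ g) ⊠ 1_x.
Proof.
rewrite !vcellE adj_comp compmA -(compmA _ ((α a b x)^†)) (assocK Hα) compm1.
by rewrite thom_adj adj1 -thom_comp comp1m.
Qed.

Lemma vcell_Madj a b k (f : Mor k (a ⊗ b)) (g : Mor k (a ⊗ b)) x :
  vcell f x ∘ (vcell g x)^† = α a b x ∘ ((f ∘ g^†) ⊠ 1_x) ∘ (α a b x)^†.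
Proof.
by rewrite !vcellE adj_comp thom_adj adj1 thomM1 !compmA.
Qed.

Lemma vcell_full n (irr : 'I_n.+1 -> Ob C) a b (m : 'I_n.+1 -> nat)
    (e : forall i, 'I_(m i) -> Mor (irr i) (a ⊗ b)) x : decomposition e ->
  \sum_i \sum_p vcell (e i p) x ∘ (vcell (e i p) x)^† = 1_(L a (L b x)).
Proof.
move=> de.
rewrite (eq_bigr (fun i => α _ _ x ∘ ((\sum_p e i p ∘ (e i p)^†) ⊠ 1_x) ∘ (α _ _ x)^†)).
  by rewrite -comp_suml -comp_sumr -thom_suml (dec_full de) thom1 compm1 (assocKV Hα).
move=> i _; rewrite thom_suml comp_sumr comp_suml; apply: eq_bigr => p _.
exact: vcell_Madj.
Qed.

Lemma vcellZ a b k z (f : Mor k (a ⊗ b)) x :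
  vcell (z *: f) x = z *: vcell f x.
Proof. by rewrite !vcellE thomZl compZr. Qed.

(** The two-cell of a morphism from the unit to [b ⊗ a]. *)
Definition rcell a b (r : Mor I (b ⊗ a)) x : Mor x (L b (L a x)) :=
  locked (vcell r x ∘ (λ x)^†).

Lemma rcellE a b (r : Mor I (b ⊗ a)) x : rcell r x = vcell r x ∘ (λ x)^†.
Proof. by rewrite /rcell -lock. Qed.

Lemma rcell_cell a b (r : Mor I (b ⊗ a)) : iscell idf (L b ⊙ L a) (rcell r).
Proof.
apply: cell_ext => [x|]; first exact: rcellE.
exact: cellM (vcell_cell r) (cell_adj cell_unit).
Qed.

Lemma rcell_nat a b (r : Mor I (b ⊗ a)) x y (f : Mor x y) :
  rcell r y ∘ f = L b ▹ L a ▹ f ∘ rcell r x.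
Proof. exact: (cnat (rcell_cell r)). Qed.

Lemma rcell_adjM a b (r s : Mor I (b ⊗ a)) x :
  (rcell r x)^† ∘ rcell s x = λ x ∘ ((r^† ∘ s) ⊠ 1_x) ∘ (λ x)^†.
Proof.
by rewrite -(vcell_adjM r s) !rcellE adj_comp adjK !compmA.
Qed.

Lemma rcell_norm a b (r : Mor I (b ⊗ a)) d x : r^† ∘ r = d *: 1_I ->
  (rcell r x)^† ∘ rcell r x = d *: 1_x.
Proof.
move=> e; rewrite rcell_adjM e thomZl thom1 compZr compm1 compZl.
by have [_ ->] := lunit_unitary T x.
Qed.

Lemma vcell_unit a b k (f : Mor k (a ⊗ b)) :
  L a ▹ ρ b ∘ vcell f I = f ∘ ρ k.
Proof. by rewrite !vcellE compmA /= runit_tensor // runit_natural. Qed.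

Lemma rcell_unit a b (r : Mor I (b ⊗ a)) : L b ▹ ρ a ∘ rcell r I = r.
Proof.
rewrite !rcellE compmA vcell_unit (lunit_runit Hα) -compmA.
by have [_ ->] := runit_unitary T I; rewrite compm1.
Qed.

(** The conjugate equation for [r] and [s] is the component at the unit object
    of the zigzag equation for their two-cells. *)
Lemma rcell_zig a b (r : Mor I (b ⊗ a)) (s : Mor I (a ⊗ b)) :
  conjugate_eq α r s -> forall x, (rcell s (L a x))^† ∘ L a ▹ rcell r x = 1_(L a x).
Proof.
move=> e x; rewrite -[RHS]scale1r.
apply: (@L_eq a (fun x => (rcell s (L a x))^† ∘ L a ▹ rcell r x)).
  apply: (@cellM _ _ _ _ (L a ⊙ (L b ⊙ L a))).
    apply: cell_asrcr; apply: cell_itgtl.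
    exact: (cell_whr (L a) (cell_adj (rcell_cell s))).
  apply: cell_isrcr; exact: (cell_whl (L a) (rcell_cell r)).
rewrite compmA -(cnat (cell_adj (rcell_cell s)) (ρ a)) scale1r -e.
rewrite -(compmA ((rcell s a)^†)) /= -thom1M.
have -> : (1_b ⊠ ρ a) ∘ rcell r I = r by exact: rcell_unit.
by rewrite !rcellE !vcellE !adj_comp adjK thom_adj adj1 !compmA.
Qed.

Section StandardDual.
Hypothesis I_irr : irreducible I.
Variables (a b : Ob C) (r : Mor I (b ⊗ a)) (s : Mor I (a ⊗ b)).
Hypotheses (a_irr : irreducible a) (std : standard_solution α r s).

Lemma std_dim : exists d, r^† ∘ r = d *: 1_I /\ s^† ∘ s = d *: 1_I.
Proof.
by have [d e] := irreducible_scalar (r^† ∘ r) I_irr; exists d; rewrite -(proj2 std).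
Qed.

(** A conjugate of an irreducible object has only scalar endomorphisms, since
    they correspond by duality to endomorphisms of the object. *)
Lemma conj_scalar (φ : forall x, Mor (L b x) (L b x)) : iscell (L b) (L b) φ ->
  exists z, forall x, φ x = z *: 1_(L b x).
Proof.
move=> c; have [[e1 e2] _] := std.
have zg := rcell_zig e1; have zag := rcell_zig e2.
have c1 : iscell (L a) (L a)
    (fun x => (rcell s (L a x))^† ∘ L a ▹ (φ (L a x) ∘ rcell r x)).
  apply: (@cellM _ _ _ _ (L a ⊙ (L b ⊙ L a))).
    apply: cell_asrcr; apply: cell_itgtl.
    exact: (cell_whr (L a) (cell_adj (rcell_cell s))).
  apply: cell_isrcr; apply: (cell_whl (L a) (F := idf)).
  apply: cellM (rcell_cell r); exact: (cell_whr (L a) c).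
have [z ez] := L_scalar a_irr c1; exists z => x.
have zagV y : L b ▹ (rcell s y)^† ∘ rcell r (L b y) = 1_(L b y).
  by apply: adj_eq; rewrite adj_comp -fm_adj adjK zag adj1.
have {c1} e y : φ (L a y) ∘ rcell r y = z *: rcell r y.
  rewrite -[LHS]comp1m -(zagV (L a y)) -compmA rcell_nat.
  by rewrite compmA -fmM ez fmZ fm1 compZl comp1m.
rewrite -[LHS]compm1 -(zagV x) compmA (cnat c).
by rewrite -compmA e compZr zagV.
Qed.

(** A standard solution for an irreducible object is spherical: both traces of a
    scalar are its product with the common norm of [r] and [s]. *)
Definition std_dual : dual (L a) (L b).
Proof.
apply: (@Dual _ _ _ (L a) (L b) (rcell r) (rcell s)).
- exact: rcell_cell.
- exact: rcell_cell.
- exact: (rcell_zig (proj1 (proj1 std))).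
- exact: (rcell_zig (proj2 (proj1 std))).
- move=> φ c x; have [z ez] := L_scalar a_irr c; have [d [d1 d2]] := std_dim.
  rewrite !ez fmZ fm1 !compZr !compm1 !compZl.
  by rewrite (rcell_norm _ d1) (rcell_norm _ d2).
- move=> φ c x; have [z ez] := conj_scalar c; have [d [d1 d2]] := std_dim.
  rewrite !ez fmZ fm1 !compZr !compm1 !compZl.
  by rewrite (rcell_norm _ d1) (rcell_norm _ d2).
Defined.
End StandardDual.
End LeftTensor.

(** * The braiding as a two-cell *)

Section Braiding.
Context {R : realType} {C : cstar_category R} {T : tensor_data C}.
Implicit Types a b c k x y : Ob C.
Local Notation "a ⊗ b" := (tob T a b) (at level 39, left associativity).
Local Notation "f ⊠ g" := (thom T f g) (at level 39, left associativity).
Local Notation I := (tunit T).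
Local Notation λ := (lunit T).
Local Notation ρ := (runit T).
Variables (α : associator_family T) (Hα : unitary_associator α).
Local Notation L := (L Hα).

(** The inverse braiding. *)
Definition rev_braiding (ε : braiding_family T) : braiding_family T :=
  fun a b => (ε b a)^†.

Lemma rev_unitary_braiding ε : unitary_braiding α ε -> unitary_braiding α (rev_braiding ε).
Proof.
move=> [u n hr hl]; rewrite /rev_braiding; split.
- by move=> a b; apply: unitaryV.
- by move=> a b a' b' f g; apply: adj_eq; rewrite !adj_comp !adjK !thom_adj n.
- move=> a b c; apply: adj_eq; rewrite !adj_comp !thom_adj !adjK !adj1 !compmA.
  by rewrite hl.
- move=> a b c; apply: adj_eq; rewrite !adj_comp !thom_adj !adjK !adj1 !compmA.
  by rewrite hr.
Qed.

(** The braiding of [a] and [b] acting on the first two factors. *)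
Definition bx (ε : braiding_family T) a b x : Mor (L a (L b x)) (L b (L a x)) :=
  locked (α b a x ∘ (ε a b ⊠ 1_x) ∘ (α a b x)^†).

Lemma bxE ε a b x : bx ε a b x = α b a x ∘ (ε a b ⊠ 1_x) ∘ (α a b x)^†.
Proof. by rewrite /bx -lock. Qed.

Lemma bx_cell ε a b : iscell (L a ⊙ L b) (L b ⊙ L a) (bx ε a b).
Proof.
apply: cell_ext => [x|]; first exact: bxE.
apply: cellM (cell_adj (cell_assoc Hα a b)).
exact: cellM (cell_assoc Hα b a) (cell_hom Hα (ε a b)).
Qed.

Lemma bx_vcell ε a b k (f : Mor k (a ⊗ b)) x :
  bx ε a b x ∘ vcell Hα f x = vcell Hα (ε a b ∘ f) x.
Proof.
rewrite !bxE !vcellE thomM1 !compmA -(compmA _ _ (α a b x)) (assocK Hα).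
by rewrite compm1.
Qed.

Lemma bx_rev ε a b x : bx (rev_braiding ε) a b x = (bx ε b a x)^†.
Proof. by rewrite !bxE /rev_braiding !adj_comp adjK thom_adj adj1 !compmA. Qed.

Lemma vcell1 a b x : vcell Hα (1_(a ⊗ b)) x = α a b x.
Proof. by rewrite !vcellE thom1 compm1. Qed.

Variables (ε : braiding_family T) (Hε : unitary_braiding α ε).

Lemma bx_unitary a b x : unitary (bx ε a b x).
Proof.
rewrite bxE; apply: unitaryM; last by apply: unitaryV; apply: assoc_unitary.
apply: unitaryM; first exact: assoc_unitary.
by apply: thom_unitary; [apply: (braid_unitary Hε)|apply: unitary1].
Qed.

Lemma assoc_natV a b c a' b' c' (f : Mor a a') (g : Mor b b') (h : Mor c c') :
  ((f ⊠ g) ⊠ h) ∘ (α a b c)^† = (α a' b' c')^† ∘ (f ⊠ (g ⊠ h)).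
Proof.
apply: (unitary_lcan (assoc_unitary Hα a' b' c')).
rewrite !compmA (assocKV Hα) comp1m (assoc_natural Hα) -compmA (assocKV Hα).
by rewrite compm1.
Qed.

(** The left hexagon, tensored with a fourth object and with all associators
    but one absorbed into the two-cells. *)
Lemma hexagonl_act a b c x :
  (1_c ⊠ α a b x) ∘ α c (a ⊗ b) x ∘ (ε (a ⊗ b) c ⊠ 1_x) ∘ (α (a ⊗ b) c x)^†
  = bx ε a c (L b x) ∘ L a ▹ bx ε b c x ∘ α a b (c ⊗ x).
Proof.
have hex : ε (a ⊗ b) c = α c a b ∘ (ε a c ⊠ 1_b) ∘ (α a c b)^† ∘ (1_a ⊠ ε b c) ∘ α a b c.
  transitivity (α c a b ∘ ((α c a b)^† ∘ ε (a ⊗ b) c ∘ (α a b c)^†) ∘ α a b c).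
    by rewrite !compmA (assocKV Hα) comp1m -compmA (assocK Hα) compm1.
  by rewrite (braid_hexagonl Hε) !compmA.
have P0 : (1_c ⊠ α a b x) ∘ α c (a ⊗ b) x ∘ (α c a b ⊠ 1_x)
    = α c a (b ⊗ x) ∘ α (c ⊗ a) b x by rewrite (assoc_pentagon Hα).
have P1 : α (a ⊗ c) b x ∘ ((α a c b)^† ⊠ 1_x)
    = (α a c (b ⊗ x))^† ∘ ((1_a ⊠ α c b x) ∘ α a (c ⊗ b) x).
  apply: (unitary_lcan (assoc_unitary Hα a c (b ⊗ x))).
  rewrite !compmA (assocKV Hα) comp1m (assoc_pentagon Hα) -compmA -thom_comp.
  by rewrite (assocKV Hα) compm1 thom1 compm1.
have P2 : α a (b ⊗ c) x ∘ (α a b c ⊠ 1_x) ∘ (α (a ⊗ b) c x)^†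
    = (1_a ⊠ (α b c x)^†) ∘ α a b (c ⊗ x).
  apply: (@unitary_lcan _ _ _ _ _ (1_a ⊠ α b c x)).
    by apply: thom_unitary; [apply: unitary1|apply: assoc_unitary].
  rewrite !compmA -(assoc_pentagon Hα) -thom1M (assocKV Hα) thom1 comp1m.
  by rewrite -compmA (assocKV Hα) compm1.
rewrite hex !thomM1 !compmA P0.
rewrite -(compmA (α c a _)) (assoc_natural Hα) thom1 compmA.
rewrite -(compmA (α c a _ ∘ _)) P1 !compmA.
rewrite -(compmA _ (α a (c ⊗ b) x)) (assoc_natural Hα) !compmA.
rewrite -(compmA _ (α a (b ⊗ c) x)) -(compmA _ (α a (b ⊗ c) x ∘ _)) P2.
by rewrite !bxE /= !thom1M !compmA.
Qed.

(** The strand [c] passes a morphism [k -> a ⊗ b]. *)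
Lemma slideL a b c k (f : Mor k (a ⊗ b)) x :
  L c ▹ vcell Hα f x ∘ bx ε k c x
  = bx ε a c (L b x) ∘ L a ▹ bx ε b c x ∘ vcell Hα f (L c x).
Proof.
rewrite [in RHS]vcellE !compmA -hexagonl_act !bxE !vcellE /= thom1M -(thom1 T c x).
rewrite -[in RHS]compmA -assoc_natV !compmA; congr (_ ∘ _).
rewrite -(compmA _ (1_c ⊠ _)) -(assoc_natural Hα) compmA -[LHS]compmA -[RHS]compmA.
by rewrite -!thomM1 (braid_natural Hε).
Qed.

(** The Yang-Baxter equation, obtained by sliding a strand past the morphisms
    [ε a b] and [1_(a ⊗ b)]. *)
Lemma yang_baxter a b c x :
  L c ▹ bx ε a b x ∘ bx ε a c (L b x) ∘ L a ▹ bx ε b c x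
  = bx ε b c (L a x) ∘ L b ▹ bx ε a c x ∘ bx ε a b (L c x).
Proof.
have e (y : Ob C) : α a b y = vcell Hα (1_(a ⊗ b)) y by rewrite vcell1.
apply: (unitary_rcan (assoc_unitary Hα a b (L c x))).
have h1 := slideL c (ε a b) x.
have h2 := slideL c (1_(a ⊗ b)) x.
rewrite -[ε a b]compm1 -!bx_vcell in h1.
rewrite -(compmA _ (bx ε a b (L c x))) [X in _ = _ ∘ (_ ∘ X)]e compmA.
rewrite -[RHS]compmA -h1 fmM e -!compmA; congr (_ ∘ _).
by rewrite [in RHS]h2 !compmA.
Qed.

End Braiding.

Section Sliding.
Context {R : realType} {C : cstar_category R} {T : tensor_data C}.
Implicit Types a b c k x y : Ob C.
Local Notation "a ⊗ b" := (tob T a b) (at level 39, left associativity).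
Variables (α : associator_family T) (Hα : unitary_associator α).
Local Notation L := (L Hα).
Variables (ε : braiding_family T) (Hε : unitary_braiding α ε).
Local Notation bx := (bx Hα ε).
Hypothesis I_irr : irreducible (tunit T).

(** The mirror image of [slideL], obtained from the inverse braiding. *)
Lemma slideR a b c k (f : Mor k (a ⊗ b)) x :
  vcell Hα f (L c x) ∘ bx c k x
  = L a ▹ bx c b x ∘ bx c a (L b x) ∘ L c ▹ vcell Hα f x.
Proof.
have h := slideL Hα (rev_unitary_braiding Hε) c f x.
rewrite !bx_rev fm_adj in h.
have [u1 u2] := bx_unitary Hα Hε c k x.
have uA := bx_unitary Hα Hε c a (L b x).
have uB := fm_unitary (L a) (bx_unitary Hα Hε c b x).
rewrite -[RHS]compm1 -u1 !compmA -(compmA _ (L c ▹ vcell Hα f x)) h !compmA.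
rewrite -(compmA _ (bx c a (L b x))) (proj2 uA) compm1 (proj2 uB) comp1m.
by [].
Qed.

(** The double braiding. *)
Definition mono a b x : Mor (L a (L b x)) (L a (L b x)) :=
  locked (bx b a x ∘ bx a b x).

Lemma monoE a b x : mono a b x = bx b a x ∘ bx a b x.
Proof. by rewrite /mono -lock. Qed.

Lemma mono_unitary a b x : unitary (mono a b x).
Proof. by rewrite monoE; apply: unitaryM; apply: bx_unitary. Qed.

(** The double braiding of [c] with the two strands [a], [b] passes a morphism
    [k -> a ⊗ b]. *)
Lemma mono_slide a b c k (f : Mor k (a ⊗ b)) x :
  L a ▹ bx c b x ∘ bx c a (L b x) ∘ (bx a c (L b x) ∘ L a ▹ bx b c x)
    ∘ vcell Hα f (L c x)
  = vcell Hα f (L c x) ∘ mono k c x.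
Proof.
by rewrite !monoE [RHS]compmA slideR -(compmA _ _ (bx k c x)) slideL // !compmA.
Qed.

Section Twist.
Variables (a b : Ob C) (D : dual (L a) (L b)) (w : R[i]).
Hypothesis tw : forall x, ptr D (bx a a x) = w *: 1_(L a x).

(** Two parallel strands [a], encircled by [c], cross each other and the first
    one is closed up: the outcome is the twist times the squared double braiding
    of [a] and [c]. *)
Lemma ptr_mono_square c x :
  ptr D (bx a a (L c x) ∘ (L a ▹ bx c a x ∘ bx c a (L a x)
           ∘ (bx a c (L a x) ∘ L a ▹ bx a c x)))
  = w *: (mono a c x ∘ mono a c x).
Proof.
(* the closed strand only meets the crossing in the middle *)
have e : bx a a (L c x) ∘ (L a ▹ bx c a x ∘ bx c a (L a x)
           ∘ (bx a c (L a x) ∘ L a ▹ bx a c x))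
   = L a ▹ mono a c x ∘ (bx a a (L c x) ∘ L a ▹ mono a c x).
  have y1 := yang_baxter Hα Hε c a a x.
  have y2 := yang_baxter Hα Hε a c a x.
  rewrite !monoE !fmM !compmA -y1.
  by rewrite -2!(compmA (L a ▹ bx c a x)) -y2 !compmA.
by rewrite e (ptrMl D) (ptrMr D) tw compZl comp1m compZr.
Qed.
End Twist.

(** Balancing: on a morphism [k -> a ⊗ b] the double braiding is the ratio of
    the twists. Both sides are the partial trace of the self-braiding of the pair
    of strands [a], [b], composed with the morphism. *)
Lemma balancing a b k a' b' k' (D : dual (L a) (L a')) (E : dual (L b) (L b'))
    (K : dual (L k) (L k')) (wa wb wk : R[i]) (f : Mor k (a ⊗ b)) x :
    (forall x, ptr D (bx a a x) = wa *: 1_(L a x)) ->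
    (forall x, ptr E (bx b b x) = wb *: 1_(L b x)) ->
    (forall x, ptr K (bx k k x) = wk *: 1_(L k x)) ->
  (wa * wb) *: (mono a b x ∘ vcell Hα f x) = wk *: vcell Hα f x.
Proof.
move=> ha hb hk.
(* the self-braiding of the pair of strands a, b *)
pose Z y : Mor (L a (L b (L a (L b y)))) (L a (L b (L a (L b y)))) :=
  L a ▹ bx a b (L b y) ∘ bx a a (L b (L b y)) ∘ (L a ▹ L a ▹ bx b b y
    ∘ L a ▹ bx b a (L b y)).
have tZ y : ptr (dual_comp D E) (Z y) = (wa * wb) *: mono a b y.
  rewrite ptr_comp /Z -fmM (ptrMr D) (ptrMl D) ha compZr compm1 compZl ptrZ.
  rewrite compmA -(yang_baxter Hα Hε b a b) -compmA (ptrMl E) (ptrMr E) hb.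
  by rewrite compZl comp1m compZr scalerA monoE.
have Zv : Z x ∘ L a ▹ L b ▹ vcell Hα f x
    = vcell Hα f (L a (L b x)) ∘ (bx a k (L b x) ∘ L a ▹ bx b k x).
  by rewrite /Z -[LHS]compmA -!fmM -slideR fmM [LHS]compmA [RHS]compmA slideR.
transitivity (ptr (dual_comp D E) (Z x) ∘ vcell Hα f x).
  by rewrite tZ compZl.
rewrite -(ptrMr (dual_comp D E)) [(L a ⊙ L b) ▹ _]/(L a ▹ L b ▹ _) Zv.
rewrite (ptr_cyclic I_irr (dual_comp D E) K (vcell_cell Hα f)).
by rewrite -slideL // (ptrMl K) hk compZr compm1.
Qed.
End Sliding.

(** * The braiding with the unit *)

Section UnitBraiding.
Context {R : realType} {C : cstar_category R} {T : tensor_data C}.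
Implicit Types a b c k x y : Ob C.
Local Notation "a ⊗ b" := (tob T a b) (at level 39, left associativity).
Local Notation "f ⊠ g" := (thom T f g) (at level 39, left associativity).
Local Notation I := (tunit T).
Local Notation λ := (lunit T).
Local Notation ρ := (runit T).
Variables (α : associator_family T) (Hα : unitary_associator α).
Local Notation L := (L Hα).

(** The braiding with the unit is given by the unit constraints: up to these it
    is a unitary [φ], and it is idempotent because the unit is isomorphic to
    its square. *)
Lemma braid_unitl ε c : unitary_braiding α ε -> ε I c = (ρ c)^† ∘ λ c.
Proof.
move=> Hε.
pose φ x : Mor (L c x) (L c x) := L c ▹ λ x ∘ bx Hα ε I c x ∘ (λ (L c x))^†.
have uφ x : unitary (φ x).
  apply: unitaryM; last by apply: unitaryV; apply: lunit_unitary.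
  by apply: unitaryM; [apply: fm_unitary; apply: lunit_unitary|apply: bx_unitary].
have vE x : vcell Hα ((λ I)^†) x = (λ (L I x))^†.
  by apply: adj_eq; rewrite vcellE adj_comp thom_adj !adjK adj1 -(lunit_tensor Hα)
    -compmA (assocKV Hα) compm1.
have lV x y (f : Mor x y) : L I ▹ f ∘ (λ x)^† = (λ y)^† ∘ f.
  by have /= n := cnat (cell_adj (cell_unit Hα)) f; rewrite n.
have cφ : iscell (L c) (L c) φ.
  apply: (@cellM _ _ _ _ (L I ⊙ L c)).
    apply: (@cellM _ _ _ _ (L c ⊙ L I)); last exact: bx_cell.
    apply: cell_itgtr; exact: (cell_whl (L c) (cell_unit Hα)).
  apply: cell_isrcl; exact: (cell_whr (L c) (cell_adj (cell_unit Hα))).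
have φφ x : φ x ∘ φ x = φ x.
  have h := slideL Hα Hε c ((λ I)^†) x; rewrite !vE in h.
  have t : φ (L I x) ∘ bx Hα ε I c x = bx Hα ε I c x.
    rewrite /φ -compmA -lV -compmA [X in _ ∘ X = _]compmA -h compmA -fmM.
    by have [_ ->] := lunit_unitary T (L I x); rewrite fm1 comp1m.
  by rewrite {2}/φ !compmA (cnat cφ) -(compmA _ (φ (L I x))) t.
have φ1 x : φ x = 1_(L c x).
  by apply: (unitary_lcan (uφ x)); rewrite φφ compm1.
have e : ρ c ∘ ε I c ∘ (λ c)^† = 1_c.
  apply: (@runit_inj _ _ T); rewrite thom1 -[RHS](φ1 I) /φ bxE.
  rewrite !compmA [L c ▹ λ I]/(1_c ⊠ λ I) (assoc_triangle Hα) -thomM1.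
  rewrite thomM1 -[RHS]compmA; congr (_ ∘ _).
  by apply: adj_eq; rewrite adj_comp thom_adj !adjK adj1 (lunit_tensor Hα).
have [u1 u2] := runit_unitary T c; have [v1 v2] := lunit_unitary T c.
by rewrite -[X in _ = X ∘ _]compm1 -e !compmA u1 comp1m -compmA v1 compm1.
Qed.

End UnitBraiding.

(** * Dimensions and twists *)

Section Twists.
Context {R : realType} {C : cstar_category R} {T : tensor_data C}.
Implicit Types a b c k x y : Ob C.
Local Notation "a ⊗ b" := (tob T a b) (at level 39, left associativity).
Local Notation "f ⊠ g" := (thom T f g) (at level 39, left associativity).
Local Notation I := (tunit T).
Local Notation λ := (lunit T).
Local Notation ρ := (runit T).
Variables (α : associator_family T) (Hα : unitary_associator α).
Local Notation L := (L Hα).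
Hypothesis I_irr : irreducible I.

Lemma conjugate_eqZ a b (r : Mor I (b ⊗ a)) (s : Mor I (a ⊗ b)) z w :
  z * w^* = 1 -> conjugate_eq α r s -> conjugate_eq α (z *: r) (w *: s).
Proof.
rewrite /conjugate_eq => zw e.
rewrite adjZ thomZl thomZr !(compZl, compZr) e scalerA.
by rewrite zw scale1r.
Qed.

Lemma conjugate_neq0 a b (r : Mor I (b ⊗ a)) (s : Mor I (a ⊗ b)) :
  irreducible a -> conjugate_eq α r s -> r <> 0 /\ s <> 0.
Proof.
rewrite /conjugate_eq => [[a0 _]] e; split=> z; apply: a0; rewrite -e z.
  by rewrite thom0r compm0 comp0m.
by rewrite adj0 thom0l compm0 !comp0m.
Qed.

Lemma pos_norm a b (r : Mor a b) : irreducible a -> r <> 0 ->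
  exists2 z : R[i], 0 < z & r^† ∘ r = z *: 1_a.
Proof.
move=> ia r0; have [z z0 e] := adj_scalar_pos r ia; exists z => //.
rewrite lt0r z0 andbT; apply/eqP => z_0; apply: r0; apply: cstar_eq0.
by rewrite e z_0 scale0r.
Qed.

(** Rescaling [r] and [s] inversely, by a fourth root of the ratio of their
    squared norms, makes the norms equal. *)
Lemma standard_exists a : irreducible a -> has_conjugates α ->
  exists b (r : Mor I (b ⊗ a)) (s : Mor I (a ⊗ b)), standard_solution α r s.
Proof.
move=> ia hc; have [b [r [s [e1 e2]]]] := hc a.
have [r0 s0] := conjugate_neq0 ia e1.
have [x x0 ex] := pos_norm I_irr r0; have [y y0 ey] := pos_norm I_irr s0.
pose t := sqrtC (sqrtC (y / x)).
have t0 : 0 < t by rewrite !sqrtC_gt0 divr_gt0.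
have tc : t^* = t by rewrite conj_Creal // gtr0_real.
have tc' : (t^-1)^* = t^-1 by rewrite conj_Creal // rpredV gtr0_real.
have tn : t != 0 by rewrite gt_eqF.
exists b, (t *: r), (t^-1 *: s); split; last first.
  rewrite !adjZ !compZl !compZr ex ey !scalerA tc tc'; congr (_ *: _).
  have -> : y = t * t * (t * t) * x.
    by rewrite -!expr2 !sqrtCK divfK // gt_eqF.
  by rewrite -!mulrA !mulKf.
split; apply: conjugate_eqZ => //; first by rewrite tc' mulfV.
by rewrite tc mulVf.
Qed.

(** The quantum dimension is attained by some standard solution. *)
Lemma qdim_spec a : irreducible a -> has_conjugates α ->
  exists b (r : Mor I (b ⊗ a)) (s : Mor I (a ⊗ b)),
    standard_solution α r s /\ r^† ∘ r = qdim α a *: 1_I.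
Proof.
move=> ia hc; have [b [r [s std]]] := standard_exists ia hc.
have [d ed] := irreducible_scalar (r^† ∘ r) I_irr.
rewrite /qdim.
have := @xgetI _ 0 [set d : R[i] | exists (b : Ob C) (r : Mor I (b ⊗ a)) (s : Mor I (a ⊗ b)),
    standard_solution α r s /\ r^† ∘ r = d *: 1_I]%classic d.
by apply; exists b, r, s.
Qed.

Section Loop.
Variables (a b : Ob C) (r : Mor I (b ⊗ a)) (s : Mor I (a ⊗ b)).
Hypotheses (a_irr : irreducible a) (std : standard_solution α r s).
Let D := std_dual Hα I_irr a_irr std.

(** The twist loop, tensored with a fixed object, is a partial trace of the
    braiding two-cell. *)
Lemma ptr_twist_loop ε w : twist_loop α ε r = w *: 1_a ->
  forall x, ptr D (bx Hα ε a a x) = w *: 1_(L a x).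
Proof.
move=> e; apply: (@L_eq _ _ _ _ _ a (fun x => ptr D (bx Hα ε a a x))).
  apply: cell_ext => [x|]; first exact: ptrE.
  apply: (@cellM _ _ _ _ (L b ⊙ (L a ⊙ L a))).
    apply: (@cellM _ _ _ _ (L b ⊙ (L a ⊙ L a))).
      apply: cell_asrcr; apply: cell_itgtl.
      exact: (cell_whr (L a) (cell_adj (dr_cell D))).
    exact: (cell_whl (L b) (bx_cell Hα ε a a)).
  apply: cell_atgtr; apply: cell_isrcl; exact: (cell_whr (L a) (dr_cell D)).
rewrite -(ptrMl D) bxE [L a ▹ ρ a]/(1_a ⊠ ρ a) !compmA (runit_tensor Hα).
rewrite -runit_natural -compmA.
have -> : ρ (a ⊗ a) ∘ (α a a I)^† = L a ▹ ρ a.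
  by rewrite -(runit_tensor Hα) -compmA (assocKV Hα) compm1.
rewrite (ptrMr D) -compmA.
have [_ ->] := runit_unitary T a; rewrite compm1 -e /twist_loop ptrE.
rewrite [dr D a]/(rcell Hα r a) -!lock vcellE !adj_comp adjK thom_adj adj1.
by rewrite !compmA.
Qed.
End Loop.

(** The twist is computed by every standard solution: by the trace property,
    applied to the identity, the partial trace does not depend on the dual. *)
Lemma twist_spec ε a b (r : Mor I (b ⊗ a)) (s : Mor I (a ⊗ b))
    (a_irr : irreducible a) (std : standard_solution α r s) x :
  ptr (std_dual Hα I_irr a_irr std) (bx Hα ε a a x) = twist α ε a *: 1_(L a x).
Proof.
have [w ew] := irreducible_scalar (twist_loop α ε r) a_irr.
have := @xgetI _ 0 [set w : R[i] | exists (b : Ob C) (r : Mor I (b ⊗ a)) (s : Mor I (a ⊗ b)),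
  standard_solution α r s /\ twist_loop α ε r = w *: 1_a]%classic w.
case; first by exists b, r, s.
move=> b' [r' [s' [std' e']]].
rewrite -(ptr_twist_loop a_irr std' e').
rewrite -[in LHS](comp1m (bx Hα ε a a x)).
rewrite (ptr_cyclic I_irr (std_dual Hα I_irr a_irr std) (std_dual Hα I_irr a_irr std')
  (cell1 (L a)) (bx Hα ε a a x)).
by rewrite compm1.
Qed.

(** An irreducible object has a dual whose partial trace yields its dimension,
    and its twist for every braiding. *)
Lemma irreducible_dual a : irreducible a -> has_conjugates α ->
  exists a' (D : dual (L a) (L a')),
  [/\ 0 < qdim α a,
      forall x, ptr D (1_(L a x)) = qdim α a *: 1_x,
      forall ε x, ptr D (bx Hα ε a a x) = twist α ε a *: 1_(L a x),
      forall φ, iscell (L a') (L a') φ -> exists z, forall x, φ x = z *: 1_(L a' x)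
    & exists s : Mor I (a ⊗ a'), s <> 0].
Proof.
move=> ia hc; have [b [r [s [std er]]]] := qdim_spec ia hc.
exists b, (std_dual Hα I_irr ia std).
have [r0 s0] := conjugate_neq0 ia (proj1 (proj1 std)).
split.
- by have [z z0] := pos_norm I_irr r0; rewrite er => /(scalar_inj I_irr) ->.
- by move=> x; rewrite ptrE fm1 compm1; apply: rcell_norm.
- by move=> ε x; apply: twist_spec.
- by move=> φ c; apply: (conj_scalar ia std c).
- by exists s.
Qed.

End Twists.

(** * Traces of the self-braidings *)

Section ModularTraces.
Context {R : realType} {C : cstar_category R} {T : tensor_data C}.
Implicit Types a b c x y : Ob C.
Local Notation "a ⊗ b" := (tob T a b) (at level 39, left associativity).
Local Notation "f ⊠ g" := (thom T f g) (at level 39, left associativity).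
Local Notation I := (tunit T).
Local Notation λ := (lunit T).
Variables (α : associator_family T) (Hα : unitary_associator α).
Local Notation L := (L Hα).
Variables (n : nat) (irr : 'I_n.+1 -> Ob C).
Hypotheses (Hf : unitary_fusion α) (Hirr : spectrum T irr).
Implicit Types i j k l : 'I_n.+1.

Lemma irr_irreducible i : irreducible (irr i).
Proof. by case: Hirr. Qed.

Lemma irr_inj i j : unitarily_iso (irr i) (irr j) -> i = j.
Proof. by case: Hirr => _ h _ _; apply: h. Qed.

Lemma irr_complete a : irreducible a -> exists i, unitarily_iso a (irr i).
Proof. by case: Hirr => _ _ h _; apply: h. Qed.

Local Notation d i := (qdim α (irr i)).

(** Duals of the irreducible objects, as provided by [irreducible_dual]. *)
Variables (cj : 'I_n.+1 -> Ob C) (D : forall i, dual (L (irr i)) (L (cj i))).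
Hypothesis d_gt0 : forall i, 0 < d i.
Hypothesis ptr_d : forall i x, ptr (D i) (1_(L (irr i) x)) = d i *: 1_x.
Hypothesis ptr_tw : forall i ε x,
  ptr (D i) (bx Hα ε (irr i) (irr i) x) = twist α ε (irr i) *: 1_(L (irr i) x).
Hypothesis cj_scalar : forall i φ, iscell (L (cj i)) (L (cj i)) φ ->
  exists z, forall x, φ x = z *: 1_(L (cj i) x).
Hypothesis cj_unit : forall i, exists s : Mor I (irr i ⊗ cj i), s <> 0.

Lemma L_scalar_inj a z w : irreducible a ->
  z *: 1_(L a I) = w *: 1_(L a I) :> Mor (L a I) (L a I) -> z = w.
Proof.
move=> ia; apply: scalar_inj.
exact: unitary_irreducible (unitaryV (runit_unitary T a)) ia.
Qed.

Lemma vcell_inj a b c (f g : Mor c (a ⊗ b)) :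
  vcell Hα f I = vcell Hα g I -> f = g.
Proof.
move=> e; apply: (unitary_rcan (runit_unitary T c)).
by rewrite -!(vcell_unit Hα) e.
Qed.

Lemma vcell_scale a b c (f : Mor c (a ⊗ b)) z w : f <> 0 ->
  z *: vcell Hα f I = w *: vcell Hα f I -> z = w.
Proof.
move=> f0; rewrite -!vcellZ => /vcell_inj /eqP.
by rewrite -subr_eq0 -scalerBl scaler_eq0 subr_eq0 => /orP [/eqP|/eqP].
Qed.

Section OneBraiding.
Variables (ε : braiding_family T) (Hε : unitary_braiding α ε).
Local Notation ω i := (twist α ε (irr i)).
Local Notation bxi i j := (bx Hα ε (irr i) (irr j)).
Local Notation mono i j := (mono Hα ε (irr i) (irr j)).

Lemma braid00 : ε (irr ord0) (irr ord0) = 1_(irr ord0 ⊗ irr ord0).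
Proof.
have [u uu] : unitarily_iso (irr ord0) I by case: Hirr.
apply: (unitary_lcan (thom_unitary T uu uu)).
rewrite -(braid_natural Hε) (braid_unitl Hα) // (lunit_runit Hα).
by have [-> _] := runit_unitary T I; rewrite comp1m compm1.
Qed.

(** The twist of the unit equals its dimension, because its self-braiding is
    trivial, so it is nonzero; and balancing makes it idempotent. *)
Lemma twist_ord0 : ω ord0 = 1.
Proof.
have b1 x : bxi ord0 ord0 x = 1_(_).
  by rewrite bxE braid00 thom1 compm1 (assocKV Hα).
have wd : ω ord0 = d ord0.
  apply: (@L_scalar_inj (irr ord0)); first exact: irr_irreducible.
  by rewrite -(ptr_tw ord0 ε) b1 ptr_d.
have [u uu] : unitarily_iso (irr ord0) I by case: Hirr.
pose f := (u ⊠ u)^† ∘ (λ I)^† ∘ u.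
have f0 : f <> 0.
  have uf : unitary f.
    exact: (unitaryM (unitaryM (unitaryV (thom_unitary T uu uu))
      (unitaryV (lunit_unitary T I))) uu).
  case: uf => uf _ f0; case: (irr_irreducible ord0) => h _; apply: h.
  by rewrite -uf f0 compm0.
have := @balancing _ _ _ _ Hα _ Hε (fusion_unit Hf) _ _ _ _ _ _ (D ord0) (D ord0)
  (D ord0) _ _ _ f I (ptr_tw ord0 ε) (ptr_tw ord0 ε) (ptr_tw ord0 ε).
rewrite monoE !b1 !comp1m => /(vcell_scale f0) ww.
have w0 : ω ord0 != 0 by rewrite wd gt_eqF.
by apply: (mulfI w0); rewrite ww mulr1.
Qed.

Lemma balancing_irr i j k (f : Mor (irr k) (irr i ⊗ irr j)) x :
  (ω i * ω j) *: (mono i j x ∘ vcell Hα f x) = ω k *: vcell Hα f x.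
Proof.
exact: (balancing Hε (fusion_unit Hf) f x (ptr_tw i ε) (ptr_tw j ε) (ptr_tw k ε)).
Qed.

(** Balancing writes a nonzero morphism from the unit to [irr i ⊗ cj i] as a
    multiple of [ω i]. *)
Lemma twist_neq0 i : ω i != 0.
Proof.
have [s s0] := cj_unit i; have [u [u1 u2]] : unitarily_iso (irr ord0) I by case: Hirr.
have [w ew] : exists w, forall x,
    ptr (dual_swap (D i)) (bx Hα ε (cj i) (cj i) x) = w *: 1_(L (cj i) x).
  apply: cj_scalar; apply: cell_ext => [x|]; first exact: ptrE.
  apply: (@cellM _ _ _ _ (L (irr i) ⊙ (L (cj i) ⊙ L (cj i)))).
    apply: (@cellM _ _ _ _ (L (irr i) ⊙ (L (cj i) ⊙ L (cj i)))).
      apply: cell_asrcr; apply: cell_itgtl.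
      exact: (cell_whr (L (cj i)) (cell_adj (ds_cell (D i)))).
    exact: (cell_whl (L (irr i)) (bx_cell Hα ε _ _)).
  apply: cell_atgtr; apply: cell_isrcl; exact: (cell_whr (L (cj i)) (ds_cell (D i))).
have := @balancing _ _ _ _ Hα _ Hε (fusion_unit Hf) _ _ _ _ _ _ (D i) (dual_swap (D i))
  (D ord0) _ _ _ (s ∘ u) I (ptr_tw i ε) ew (ptr_tw ord0 ε).
have f0 : s ∘ u <> 0.
  by move=> f0; apply: s0; rewrite -[s]compm1 -u2 compmA f0 comp0m.
rewrite twist_ord0 => e; apply/eqP => w0; move: e; rewrite w0 mul0r scale0r.
rewrite -(scale0r (vcell Hα (s ∘ u) I)) => /(vcell_scale f0) /eqP.
by rewrite eq_sym oner_eq0.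
Qed.

Lemma mono_vcell i j k (f : Mor (irr k) (irr i ⊗ irr j)) x :
  mono i j x ∘ vcell Hα f x = (ω k / (ω i * ω j)) *: vcell Hα f x.
Proof.
have w0 : ω i * ω j != 0 by rewrite mulf_neq0 ?twist_neq0.
by rewrite mulrC -scalerA -balancing_irr scalerA mulVf // scale1r.
Qed.

(** The double braiding is unitary, so its eigenvalues are phases. *)
Lemma mono_phase i j k (f : Mor (irr k) (irr i ⊗ irr j)) : f <> 0 ->
  (ω i * ω j / ω k)^* = ω k / (ω i * ω j).
Proof.
move=> f0; set m := ω k / _.
have -> : ω i * ω j / ω k = m^-1 by rewrite /m invf_div.
have m0 : m != 0 by rewrite mulf_neq0 ?invr_eq0 ?mulf_neq0 ?twist_neq0.
suff mm : m^* * m = 1.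
  have -> : m^-1 = m^* by apply: (mulIf m0); rewrite mulVf.
  exact: conjCK.
have [u _] := mono_unitary Hα Hε (irr i) (irr j) I.
pose v := vcell Hα f I.
have v0 : v^† ∘ v <> 0.
  move/cstar_eq0 => v0; have : 1 *: v = 0 *: v by rewrite v0 !scaler0.
  by move/(vcell_scale f0)/eqP; rewrite oner_eq0.
have e : (m^* * m) *: (v^† ∘ v) = 1 *: (v^† ∘ v).
  rewrite scale1r -scalerA -[m *: _]compZr -compZl -adjZ -/m -mono_vcell -/v.
  by rewrite adj_comp compmA -(compmA (v^†)) u compm1.
move/eqP: e; rewrite -subr_eq0 -scalerBl scaler_eq0 subr_eq0.
by case/orP => /eqP.
Qed.

(** The trace of an endomorphism of a pair of strands which is scalar on every
    irreducible component. *)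
Lemma ptr_pair i j m (e : forall k, 'I_(m k) -> Mor (irr k) (irr i ⊗ irr j))
    (c : 'I_n.+1 -> R[i]) x (h : Mor (L (irr i) (L (irr j) x)) (L (irr i) (L (irr j) x))) :
    decomposition e ->
    (forall k p, h ∘ vcell Hα (e k p) x = c k *: vcell Hα (e k p) x) ->
  ptr (D j) (ptr (D i) h) = (\sum_k (m k)%:R * c k * d k) *: 1_x.
Proof.
move=> de he; rewrite -ptr_comp.
rewrite -[h]compm1 -(vcell_full Hα _ de) comp_sumr ptr_sum scaler_suml; apply: eq_bigr => k _.
rewrite comp_sumr ptr_sum (eq_bigr (fun _ => (c k * d k) *: 1_x)).
  by rewrite sumr_const card_ord -scaler_nat scalerA mulrA.
move=> p _; rewrite compmA he compZl ptrZ.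
rewrite (ptr_cyclic (fusion_unit Hf) _ (D k) (vcell_cell Hα (e k p))).
by rewrite vcell_adjM (dec_ortho de) eqxx scale1r thom1 ptr_d scalerA.
Qed.

Local Notation N i j k := (fusion_mult T irr i j k).
Local Notation sub := (fusion_subobjects Hf).

Lemma pair_decomposition a : exists (m : 'I_n.+1 -> nat)
    (e : forall k, 'I_(m k) -> Mor (irr k) a),
  decomposition e /\ forall k, m k = \dim (fullv : {vspace Mor (irr k) a}).
Proof.
have [m [e de]] := exists_decomposition irr_irreducible irr_inj irr_complete sub a.
exists m, e; split=> // k; exact: (decomposition_dim irr_irreducible irr_inj k de).
Qed.

(** The trace of the double braiding is an entry of the conjugate of [Y]. *)
Lemma ptr_mono k j x :
  ptr (D j) (ptr (D k) (mono k j x)) = (Ymx α ε irr k j)^* *: 1_x.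
Proof.
have [m [e [de em]]] := pair_decomposition (irr k ⊗ irr j).
rewrite (ptr_pair (c := fun l => ω l / (ω k * ω j)) de); last first.
  by move=> l p; apply: mono_vcell.
congr (_ *: _); rewrite mxE rmorph_sum; apply: eq_bigr => l _ /=.
rewrite /fusion_mult -em; case: (posnP (m l)) => [->|ml]; first by rewrite !mul0r rmorph0.
have dl : (d l)^* = d l by rewrite conj_Creal ?gtr0_real.
have aux (N : nat) (z y : R[i]) : y^* = y -> (N%:R * z * y)^* = N%:R * z^* * y.
  by rewrite !rmorphM /= rmorph_nat => ->.
rewrite aux // (mono_phase (f := e l (Ordinal ml))) //.
move=> e0; have := dec_ortho de (Ordinal ml) (Ordinal ml); rewrite e0 compm0 eqxx scale1r.
by move/esym; case: (irr_irreducible l).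
Qed.

(** The traces of the self-braiding of [irr i] on the Hom spaces
    [Mor (irr k) (irr i ⊗ irr i)], weighted by the conjugate of [Y], are determined
    by the fusion rules, the dimensions and the twists. Both sides are the value of
    a strand [irr i] closed up after winding twice around a closed strand
    [irr j]. *)
Lemma self_braiding_trace i (m : 'I_n.+1 -> nat)
    (e : forall k, 'I_(m k) -> Mor (irr k) (irr i ⊗ irr i))
    (t : forall k, 'I_(m k) -> R[i]) j : decomposition e ->
    (forall k p, (e k p)^† ∘ (ε (irr i) (irr i) ∘ e k p) = t k p *: 1_(irr k)) ->
  \sum_k (\sum_p t k p) * (Ymx α ε irr k j)^*
  = ω i * \sum_l (N i j l)%:R * (ω l / (ω i * ω j)) ^+ 2 * d l.
Proof.
move=> de et; apply: (scalar_inj (fusion_unit Hf)).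
pose M x := L (irr i) ▹ bxi j i x ∘ bxi j i (L (irr i) x)
  ∘ (bxi i j (L (irr i) x) ∘ L (irr i) ▹ bxi i j x).
(* the common value is a trace over the three strands [irr i], [irr i], [irr j] *)
transitivity (ptr (D j) (ptr (D i) (ptr (D i) (bxi i i (L (irr j) I) ∘ M I)))); last first.
  rewrite /M (ptr_mono_square Hε (ptr_tw i ε)) !ptrZ -[RHS]scalerA; congr (_ *: _).
  have [m' [e' [de' em']]] := pair_decomposition (irr i ⊗ irr j).
  rewrite (ptr_pair (c := fun l => (ω l / (ω i * ω j)) ^+ 2) de').
    by congr (_ *: _); apply: eq_bigr => l _; rewrite em'.
  by move=> k p; rewrite -compmA mono_vcell compZr mono_vcell scalerA.
set X := L (irr j) I.
rewrite -[bxi i i X ∘ M I]compm1 -(vcell_full Hα _ de) comp_sumr scaler_suml.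
rewrite -ptr_comp !ptr_sum; apply: eq_bigr => k _.
rewrite comp_sumr !ptr_sum mulr_suml scaler_suml; apply: eq_bigr => p _.
rewrite compmA -(compmA (bxi i i X)) mono_slide // compmA bx_vcell -compmA.
rewrite (ptr_cyclic (fusion_unit Hf) _ (D k) (vcell_cell Hα (ε (irr i) (irr i) ∘ e k p))).
rewrite -compmA vcell_adjM et thomZl thom1 compZr compm1 !ptrZ ptr_mono.
by rewrite scalerA.
Qed.

Lemma mono_hom i j k (f : Mor (irr k) (irr i ⊗ irr j)) :
  ε (irr j) (irr i) ∘ (ε (irr i) (irr j) ∘ f) = (ω k / (ω i * ω j)) *: f.
Proof. by apply: vcell_inj; rewrite -!bx_vcell compmA -monoE mono_vcell vcellZ. Qed.

End OneBraiding.

Section TwoBraidings.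
Variables (ε ε' : braiding_family T).
Hypotheses (Hε : unitary_braiding α ε) (Hε' : unitary_braiding α ε').
Hypothesis twE : forall i, twist α ε (irr i) = twist α ε' (irr i).
Hypothesis Y_unit : Ymx α ε irr \in unitmx.

Lemma double_braiding_agree i j :
  ε (irr j) (irr i) ∘ ε (irr i) (irr j) = ε' (irr j) (irr i) ∘ ε' (irr i) (irr j).
Proof.
have [m [e [de _]]] := pair_decomposition (irr i ⊗ irr j).
apply: (dec_separate de) => k p.
by rewrite -!compmA (mono_hom Hε) (mono_hom Hε') !twE.
Qed.

(** The matrix [Y] being invertible, the weighted traces determine the traces. *)
Lemma self_braiding_traces_agree i m m' e e' t t' k :
    @decomposition _ _ _ irr (irr i ⊗ irr i) m e ->
    @decomposition _ _ _ irr (irr i ⊗ irr i) m' e' ->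
    (forall k p, (e k p)^† ∘ (ε (irr i) (irr i) ∘ e k p) = t k p *: 1_(irr k)) ->
    (forall k p, (e' k p)^† ∘ (ε' (irr i) (irr i) ∘ e' k p) = t' k p *: 1_(irr k)) ->
  \sum_(p < m k) t k p = \sum_(p < m' k) t' k p :> R[i].
Proof.
move=> de de' et et'.
(* the row of conjugated differences is in the kernel of [Y] *)
pose u : 'rV[R[i]]_n.+1 := \row_l ((\sum_(p < m l) t l p - \sum_(p < m' l) t' l p)^*).
have YE : Ymx α ε' irr = Ymx α ε irr.
  by apply/matrixP => l j; rewrite !mxE; apply: eq_bigr => q _; rewrite !twE.
have u0 : u *m Ymx α ε irr = 0.
  apply/rowP => j; rewrite !mxE; apply: (can_inj conjCK); rewrite rmorph0 rmorph_sum.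
  have h1 := self_braiding_trace Hε j de et.
  have h2 := self_braiding_trace Hε' j de' et'.
  apply: (@etrans _ _ (\sum_l (\sum_(p < m l) t l p) * (Ymx α ε irr l j)^*
    - \sum_l (\sum_(p < m' l) t' l p) * (Ymx α ε' irr l j)^*)).
    rewrite -sumrB; apply: eq_bigr => l _; rewrite YE -mulrBl [u _ _]mxE rmorphM.
    by congr (_ * _); exact: conjCK.
  rewrite h1 h2 twE; apply/eqP; rewrite subr_eq0; apply/eqP; congr (_ * _).
  by apply: eq_bigr => l _; rewrite !twE.
have : u = 0 by rewrite -[u](mulmxK Y_unit) u0 mul0mx.
move/rowP/(_ k); rewrite !mxE => /(congr1 (fun z => z^*)) /eqP.
by rewrite conjCK rmorph0 subr_eq0 => /eqP.
Qed.

Lemma sum_signs (N q : nat) (μ : R[i]) : (q <= N)%N ->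
  \sum_(p < N) (if (p < q)%N then μ else - μ) = q%:R * (2 * μ) - N%:R * μ.
Proof.
move=> qN; rewrite -(big_mkord xpredT (fun p => if (p < q)%N then μ else - μ)).
rewrite (big_cat_nat (n := q)) //= (eq_big_nat _ _ (F2 := fun=> μ)); last first.
  by move=> p /andP [_ ->].
rewrite [X in _ + X](eq_big_nat _ _ (F2 := fun=> - μ)); last first.
  by move=> p /andP [qp _]; rewrite ltnNge qp.
rewrite !sumr_const_nat subn0 mulNrn mulrnBr // opprB addrA.
by rewrite !mulr_natl mulr2n mulrnDl.
Qed.

(** The self-braidings of [irr i] are unitarily conjugate: on each Hom space they
    have the same scalar square and the same trace, hence the same eigenvalues
    with the same multiplicities. *)
Lemma self_braiding_conjugate i : exists2 u : Mor (irr i ⊗ irr i) (irr i ⊗ irr i),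
  unitary u & u ∘ ε' (irr i) (irr i) = ε (irr i) (irr i) ∘ u.
Proof.
pose μ k := sqrtC (twist α ε (irr k) / (twist α ε (irr i) * twist α ε (irr i))).
have μ0 k : μ k != 0.
  by rewrite sqrtC_eq0 mulf_neq0 ?invr_eq0 ?mulf_neq0 ?(twist_neq0 Hε).
have cc ε0 (H0 : unitary_braiding α ε0) k (f : Mor (irr k) (irr i ⊗ irr i)) :
    (forall j, twist α ε0 (irr j) = twist α ε (irr j)) ->
    ε0 (irr i) (irr i) ∘ (ε0 (irr i) (irr i) ∘ f) = μ k ^+ 2 *: f.
  by move=> tw; rewrite (mono_hom H0) !tw sqrtCK.
have [q [e [de qe ee]]] := eigen_decomposition irr_irreducible irr_inj irr_complete
  (fusion_subobjects Hf) (braid_unitary Hε _ _) μ0 (fun k f => cc ε Hε k f (fun=> erefl)).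
have [q' [e' [de' qe' ee']]] := eigen_decomposition irr_irreducible irr_inj irr_complete
  (fusion_subobjects Hf) (braid_unitary Hε' _ _) μ0
  (fun k f => cc ε' Hε' k f (fun j => esym (twE j))).
(* the trace determines the multiplicity of the eigenvalue [μ k] *)
have qq k : q k = q' k.
  pose t q k (p : 'I_(fusion_mult T irr i i k)) := if (p < q k)%N then μ k else - μ k.
  have te q0 (c0 : Mor (irr i ⊗ irr i) (irr i ⊗ irr i)) e0 :
      @decomposition _ _ _ irr (irr i ⊗ irr i) _ e0 ->
      (forall k p, c0 ∘ e0 k p
         = (if (p < q0 k)%N then μ k else - μ k) *: e0 k p) ->
      forall k p, (e0 k p)^† ∘ (c0 ∘ e0 k p) = t q0 k p *: 1_(irr k).
    by move=> d0 h0 k0 p; rewrite h0 compZr (dec_ortho d0) eqxx scale1r.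
  have := self_braiding_traces_agree k de de' (te q _ e de ee) (te q' _ e' de' ee').
  rewrite /t !sum_signs // => /addIr /mulIf; rewrite mulf_neq0 ?pnatr_eq0 // => /(_ isT).
  by move/eqP; rewrite eqr_nat => /eqP.
have [u uu ue] := decomposition_unitary irr_irreducible irr_inj de' de.
exists u => //; apply: (dec_separate de') => k p.
by rewrite -!compmA ee' compZr !ue ee qq.
Qed.

End TwoBraidings.
End ModularTraces.

(** * Transport of the associator *)

Section Transport.
Context {R : realType} {C : cstar_category R} {T : tensor_data C}.
Implicit Types a b c x y : Ob C.
Local Notation "a ⊗ b" := (tob T a b) (at level 39, left associativity).
Local Notation "f ⊠ g" := (thom T f g) (at level 39, left associativity).
Local Notation I := (tunit T).
Local Notation λ := (lunit T).
Local Notation ρ := (runit T).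
Variables (α : associator_family T) (Hα : unitary_associator α).
Variable U : tensor_endo_family T.
Hypothesis U_unitary : forall a b, unitary (U a b).
Hypothesis U_natural : forall a b a' b' (f : Mor a a') (g : Mor b b'),
  U a' b' ∘ (f ⊠ g) = (f ⊠ g) ∘ U a b.
Hypothesis U_l : forall a, U I a = 1_(I ⊗ a).
Hypothesis U_r : forall a, U a I = 1_(a ⊗ I).

(** The associator making [(Id, U, 1)] a tensor equivalence from the tensor
    structure with associator [α]. *)
Definition transport_associator : associator_family T := fun a b c =>
  locked ((1_a ⊠ U b c)^† ∘ (U a (b ⊗ c))^† ∘ α a b c ∘ U (a ⊗ b) c ∘ (U a b ⊠ 1_c)).
Local Notation β := transport_associator.

Lemma UK a b : (U a b)^† ∘ U a b = 1_(a ⊗ b).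
Proof. by case: (U_unitary a b). Qed.

Lemma UKV a b : U a b ∘ (U a b)^† = 1_(a ⊗ b).
Proof. by case: (U_unitary a b). Qed.

Lemma U1KV a b c : (1_a ⊠ U b c) ∘ (1_a ⊠ (U b c)^†) = 1_(a ⊗ (b ⊗ c)).
Proof. by rewrite -thom1M UKV thom1. Qed.

Lemma UKV1 a b c : (U a b ⊠ 1_c) ∘ ((U a b)^† ⊠ 1_c) = 1_(a ⊗ b ⊗ c).
Proof. by rewrite -thomM1 UKV thom1. Qed.

Lemma U_naturalV a b a' b' (f : Mor a a') (g : Mor b b') :
  (U a' b')^† ∘ (f ⊠ g) = (f ⊠ g) ∘ (U a b)^†.
Proof. by apply: adj_eq; rewrite !adj_comp thom_adj !adjK U_natural. Qed.

Lemma U1_unitary a b c : unitary (1_a ⊠ U b c).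
Proof. by apply: thom_unitary => //; apply: unitary1. Qed.

Lemma U2_unitary a b c : unitary (U a b ⊠ 1_c).
Proof. by apply: thom_unitary => //; apply: unitary1. Qed.

Lemma transportE a b c :
  U a (b ⊗ c) ∘ (1_a ⊠ U b c) ∘ β a b c = α a b c ∘ U (a ⊗ b) c ∘ (U a b ⊠ 1_c).
Proof.
rewrite /β -lock thom_adj adj1 !compmA -(compmA (U a (b ⊗ c))) U1KV compm1 UKV.
by rewrite comp1m.
Qed.

Lemma transport_unitary a b c : unitary (β a b c).
Proof.
rewrite /β -lock; do ![apply: unitaryM] => //; last exact: U2_unitary.
- exact/unitaryV/U1_unitary.
- exact: unitaryV.
- exact: assoc_unitary.
Qed.

Lemma transport_natural a b c a' b' c' (f : Mor a a') (g : Mor b b') (h : Mor c c') :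
  β a' b' c' ∘ ((f ⊠ g) ⊠ h) = (f ⊠ (g ⊠ h)) ∘ β a b c.
Proof.
apply: (unitary_lcan (U1_unitary a' b' c')).
apply: (unitary_lcan (U_unitary a' (b' ⊗ c'))).
rewrite !compmA transportE -[LHS]compmA -thom_comp U_natural comp1m.
rewrite -[h in LHS]compm1 thom_comp.
rewrite compmA -(compmA (α a' b' c')) U_natural compmA (assoc_natural Hα).
rewrite -(compmA (U a' (b' ⊗ c'))) -thom_comp comp1m (U_natural g h) -[f in RHS]compm1.
rewrite thom_comp !compmA (U_natural f (g ⊠ h)).
by rewrite -[RHS]compmA -[RHS]compmA [X in _ = _ ∘ X]compmA transportE !compmA.
Qed.

(** After composition with the unitary [V], both sides of the pentagon become
    the corresponding side of the pentagon of [α] followed by [W]. *)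
Lemma transport_pentagon a b c d :
  β a b (c ⊗ d) ∘ β (a ⊗ b) c d
  = (1_a ⊠ β b c d) ∘ β a (b ⊗ c) d ∘ (β a b c ⊠ 1_d).
Proof.
pose V := U a (b ⊗ (c ⊗ d)) ∘ (1_a ⊠ U b (c ⊗ d)) ∘ (1_a ⊠ (1_b ⊠ U c d)).
pose W := U (a ⊗ b ⊗ c) d ∘ (U (a ⊗ b) c ⊠ 1_d) ∘ ((U a b ⊠ 1_c) ⊠ 1_d).
have uV : unitary V.
  apply: unitaryM; last by apply: thom_unitary; [apply: unitary1|apply: U1_unitary].
  by apply: unitaryM => //; apply: U1_unitary.
apply: (unitary_lcan uV).
transitivity (α a b (c ⊗ d) ∘ α (a ⊗ b) c d ∘ W).
  have h1 := transport_natural (1_a) (1_b) (U c d); rewrite thom1 in h1.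
  have h2 := transport_natural (U a b) (1_c) (1_d); rewrite thom1 in h2.
  rewrite /V !compmA (rea (esym h1)) compmA transportE.
  rewrite -(compmA _ (U a b ⊠ 1_(c ⊗ d))) thom_swap compmA.
  rewrite -(compmA _ (U a b ⊠ 1_(c ⊗ d))) -h2 compmA.
  have := transportE (a ⊗ b) c d; rewrite -compmA => /rea e.
  rewrite -(compmA _ (1_(a ⊗ b) ⊠ U c d)) e.
  by rewrite /W !compmA.
have h3 := transport_natural (1_a) (U b c) (1_d).
rewrite (assoc_pentagon Hα) /V -!compmA.
have -> : (1_a ⊠ U b (c ⊗ d)) ∘ ((1_a ⊠ (1_b ⊠ U c d)) ∘ ((1_a ⊠ β b c d) ∘ (β a (b ⊗ c) d ∘ (β a b c ⊠ 1_d))))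
   = (1_a ⊠ (α b c d ∘ U (b ⊗ c) d)) ∘ (β a (b ⊗ c) d ∘ (((1_a ⊠ U b c) ∘ β a b c) ⊠ 1_d)).
  rewrite !compmA -!thom1M transportE thom1M (rea (esym h3)) -!compmA.
  by rewrite -thomM1.
rewrite thom1M !compmA U_natural -(compmA _ (1_a ⊠ U (b ⊗ c) d)).
rewrite -(compmA _ (U a (b ⊗ c ⊗ d))) [U a (b ⊗ c ⊗ d) ∘ _]compmA transportE.
rewrite /W -!compmA; congr (_ ∘ (_ ∘ _)).
rewrite -[in RHS]thomM1 [in RHS]compmA transportE !thomM1 !compmA.
by rewrite (U_natural (α a b c)).
Qed.

Lemma transport_triangle a b : (1_a ⊠ λ b) ∘ β a I b = ρ a ⊠ 1_b.
Proof.
rewrite /β -lock U_l U_r !thom1 adj1 comp1m compm1 !compmA.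
rewrite -U_naturalV -[LHS]compmA -compmA [X in _ ∘ X]compmA (assoc_triangle Hα).
by rewrite -U_natural compmA UK comp1m.
Qed.

Lemma transport_unitary_associator : unitary_associator β.
Proof.
split; [exact: transport_unitary | exact: transport_natural |
  exact: transport_pentagon | exact: transport_triangle].
Qed.

(** Solutions of the conjugate equations are transported along [U]. *)
Lemma transport_conjugate_eq a b (r : Mor I (b ⊗ a)) (s : Mor I (a ⊗ b)) :
  conjugate_eq α r s -> conjugate_eq β ((U b a)^† ∘ r) ((U a b)^† ∘ s).
Proof.
rewrite /conjugate_eq => e0; rewrite -[RHS]e0.
have e : (β a b a)^† = ((U a b)^† ⊠ 1_a) ∘ (U (a ⊗ b) a)^† ∘ (α a b a)^†
    ∘ U a (b ⊗ a) ∘ (1_a ⊠ U b a).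
  by rewrite /β -lock !adj_comp !adjK thom_adj adj1 !compmA.
rewrite e adj_comp adjK thomM1 thom1M !compmA.
rewrite -(compmA _ (U a b ⊠ 1_a)) UKV1 compm1.
rewrite -(compmA _ (1_a ⊠ U b a)) U1KV compm1.
have n1 : (s^† ⊠ 1_a) ∘ (U (a ⊗ b) a)^† = s^† ⊠ 1_a.
  by rewrite -U_naturalV U_l adj1 comp1m.
have n2 : U a (b ⊗ a) ∘ (1_a ⊠ r) = 1_a ⊠ r.
  by rewrite U_natural U_r compm1.
by rewrite (rea n1) (rea n2).
Qed.

Lemma transport_has_conjugates : has_conjugates α -> has_conjugates β.
Proof.
move=> hc a; have [b [r [s [e1 e2]]]] := hc a.
exists b, ((U b a)^† ∘ r), ((U a b)^† ∘ s).
by split; apply: transport_conjugate_eq.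
Qed.

Lemma transport_equivalence : unitary_tensor_equivalence α β U.
Proof.
split => //; last exact: transportE.
- by move=> a; rewrite U_l compm1.
- by move=> a; rewrite U_r compm1.
Qed.

Lemma braidedE ε ε' a b : braided U ε ε' -> ε' a b = (U b a)^† ∘ ε a b ∘ U a b.
Proof. by move=> Ub; rewrite -compmA -(Ub a b) compmA UK comp1m. Qed.

Lemma braided_rev ε ε' : unitary_braiding α ε -> braided U ε ε' ->
  braided U (rev_braiding ε) (rev_braiding ε').
Proof.
move=> Hε Ub a b; rewrite /rev_braiding.
have [u1 u2] := braid_unitary Hε b a.
rewrite (braidedE b a Ub) !adj_comp adjK !compmA UKV comp1m.
by [].
Qed.

Lemma transport_hexagonr ε ε' a b c : unitary_braiding α ε -> braided U ε ε' ->
  β b c a ∘ ε' a (b ⊗ c) ∘ β a b c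
  = (1_b ⊠ ε' a c) ∘ β b a c ∘ (ε' a b ⊠ 1_c).
Proof.
move=> Hε Ub.
apply: (unitary_lcan (U1_unitary b c a)).
apply: (unitary_lcan (U_unitary b (c ⊗ a))).
transitivity (α b c a ∘ ε a (b ⊗ c) ∘ α a b c ∘ U (a ⊗ b) c ∘ (U a b ⊠ 1_c)).
  rewrite !compmA transportE -(compmA _ (U (b ⊗ c) a)) U_natural !compmA.
  rewrite -(compmA _ (U (b ⊗ c) a)) Ub !compmA -(compmA _ (U b c ⊠ 1_a)).
  rewrite -(braid_natural Hε) !compmA -(compmA _ (1_a ⊠ U b c)) -U_natural.
  by rewrite -!compmA [U a (b ⊗ c) ∘ _]compmA transportE !compmA.
rewrite (braid_hexagonr Hε) !compmA -(compmA (U b _)) -thom1M Ub thom1M compmA.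
rewrite (U_natural (1_b) (ε a c)) -!(compmA (1_b ⊠ ε a c)) transportE.
rewrite -!compmA; congr (_ ∘ (_ ∘ _)).
by rewrite -thomM1 Ub thomM1 !compmA (U_natural (ε a b)).
Qed.

Lemma transport_braiding ε ε' :
  unitary_braiding α ε -> braided U ε ε' -> unitary_braiding β ε'.
Proof.
move=> Hε Ub.
have uV a b : unitary (ε' a b).
  rewrite (braidedE a b Ub); apply: unitaryM => //; apply: unitaryM; first exact: unitaryV.
  exact: (braid_unitary Hε).
split=> // [a b a' b' f g|a b c|a b c].
- rewrite !(braidedE _ _ Ub) -[LHS]compmA U_natural !compmA -(compmA _ (ε a' b')).
  by rewrite (braid_natural Hε) compmA U_naturalV.
- exact: (transport_hexagonr a b c Hε Ub).
(* the left hexagon is the adjoint of the right hexagon of the inverse braiding *)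
- have := transport_hexagonr c a b (rev_unitary_braiding Hε) (braided_rev Hε Ub).
  move/(congr1 (fun f => f^†)); rewrite /rev_braiding !adj_comp !thom_adj !adjK !adj1.
  by rewrite !compmA.
Qed.

End Transport.

(** * Natural families with prescribed components *)

Section Extension.
Context {R : realType} {C : cstar_category R} {T : tensor_data C}.
Implicit Types a b c x y : Ob C.
Local Notation "a ⊗ b" := (tob T a b) (at level 39, left associativity).
Local Notation "f ⊠ g" := (thom T f g) (at level 39, left associativity).
Variables (n : nat) (irr : 'I_n.+1 -> Ob C).
Implicit Types i j k l : 'I_n.+1.
Hypothesis irrI : forall i, irreducible (irr i).
Hypothesis irrN : forall i j, unitarily_iso (irr i) (irr j) -> i = j.
Hypothesis irrE : forall a, irreducible a -> exists i, unitarily_iso a (irr i).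
Hypothesis sub : has_subobjects C.

(** Morphisms out of a tensor product are determined on pairs of irreducibles. *)
Lemma pair_separate a b c (f g : Mor (a ⊗ b) c) :
  (forall i j (v : Mor (irr i) a) (w : Mor (irr j) b), f ∘ (v ⊠ w) = g ∘ (v ⊠ w)) ->
  f = g.
Proof.
move=> h.
have [m [e de]] := exists_decomposition irrI irrN irrE sub a.
have [m' [e' de']] := exists_decomposition irrI irrN irrE sub b.
rewrite -[f]compm1 -[g]compm1 -(thom1 T a b) -(dec_full de) -(dec_full de').
rewrite !thom_suml !comp_sumr; apply: eq_bigr => i _.
rewrite !thom_suml !comp_sumr; apply: eq_bigr => p _.
rewrite !thom_sumr !comp_sumr; apply: eq_bigr => j _.
rewrite !thom_sumr !comp_sumr; apply: eq_bigr => q _.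
by rewrite thom_comp !compmA h.
Qed.

(** A chosen decomposition of every object. *)
Variable (m : Ob C -> 'I_n.+1 -> nat).
Variable (e : forall a k, 'I_(m a k) -> Mor (irr k) a).
Arguments e : clear implicits.
Hypothesis de : forall a, decomposition (e a).

(** The natural family with prescribed components on pairs of irreducibles. *)
Definition extend (u : forall i j, Mor (irr i ⊗ irr j) (irr i ⊗ irr j)) :
    tensor_endo_family T := fun a b =>
  \sum_i \sum_p \sum_j \sum_q
    (e a i p ⊠ e b j q) ∘ u i j ∘ (e a i p ⊠ e b j q)^†.

Lemma extend_irr u a b i j (v : Mor (irr i) a) (w : Mor (irr j) b) :
  extend u a b ∘ (v ⊠ w) = (v ⊠ w) ∘ u i j.
Proof.
have vE : v = \sum_p e a i p ∘ ((e a i p)^† ∘ v).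
  rewrite -[LHS]comp1m -(dec_full (de a)) comp_suml (bigD1 i) //= [X in _ + X]big1 ?addr0.
    by rewrite comp_suml; apply: eq_bigr => p _; rewrite compmA.
  move=> k ki; rewrite comp_suml big1 // => p _.
  by rewrite -compmA (irr_hom0 irrI irrN ((e a k p)^† ∘ v)) ?compm0 //;
    apply/eqP; rewrite eq_sym.
have wE : w = \sum_q e b j q ∘ ((e b j q)^† ∘ w).
  rewrite -[LHS]comp1m -(dec_full (de b)) comp_suml (bigD1 j) //= [X in _ + X]big1 ?addr0.
    by rewrite comp_suml; apply: eq_bigr => p _; rewrite compmA.
  move=> k ki; rewrite comp_suml big1 // => p _.
  by rewrite -compmA (irr_hom0 irrI irrN ((e b k p)^† ∘ w)) ?compm0 //;
    apply/eqP; rewrite eq_sym.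
rewrite {2}vE {2}wE /extend comp_suml (bigD1 i) //= [X in _ + X]big1 ?addr0; last first.
  move=> k ki; rewrite comp_suml big1 // => p _; rewrite comp_suml big1 // => l _.
  rewrite comp_suml big1 // => q _; rewrite -compmA thom_adj -thom_comp.
  by rewrite (irr_hom0 irrI irrN ((e a k p)^† ∘ v)) ?thom0l ?compm0 //; apply/eqP; rewrite eq_sym.
rewrite comp_suml thom_suml comp_suml; apply: eq_bigr => p _.
rewrite comp_suml (bigD1 j) //= [X in _ + X]big1 ?addr0; last first.
  move=> l lj; rewrite comp_suml big1 // => q _; rewrite -compmA thom_adj -thom_comp.
  rewrite (irr_hom0 irrI irrN ((e b l q)^† ∘ w)) ?thom0r ?compm0 //.
  by apply/eqP; rewrite eq_sym.
rewrite comp_suml thom_sumr comp_suml; apply: eq_bigr => q _.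
rewrite -[LHS]compmA thom_adj -thom_comp.
have [z ->] := irreducible_scalar ((e a i p)^† ∘ v) (irrI i).
have [y ->] := irreducible_scalar ((e b j q)^† ∘ w) (irrI j).
by rewrite !(thomZl, thomZr, compZl, compZr) thom1 !compm1.
Qed.

Lemma extend_adj u a b :
  (extend u a b)^† = extend (fun i j => (u i j)^†) a b.
Proof.
rewrite /extend adj_sum; apply: eq_bigr => i _; rewrite adj_sum; apply: eq_bigr => p _.
rewrite adj_sum; apply: eq_bigr => j _; rewrite adj_sum; apply: eq_bigr => q _.
by rewrite !adj_comp adjK compmA.
Qed.

Lemma extend_unitary u : (forall i j, unitary (u i j)) ->
  forall a b, unitary (extend u a b).
Proof.
move=> uu a b; split; apply: pair_separate => i j v w;
  rewrite extend_adj -compmA !extend_irr compmA extend_irr -compmA comp1m.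
  by have [-> _] := uu i j; rewrite compm1.
by have [_ ->] := uu i j; rewrite compm1.
Qed.

Lemma extend_natural u a b a' b' (f : Mor a a') (g : Mor b b') :
  extend u a' b' ∘ (f ⊠ g) = (f ⊠ g) ∘ extend u a b.
Proof.
apply: pair_separate => i j v w.
by rewrite -[RHS]compmA extend_irr compmA -thom_comp -compmA -thom_comp extend_irr.
Qed.

End Extension.

(** * The equivalence *)

Section Data.
Context {R : realType} {C : cstar_category R} {T : tensor_data C}.
Local Notation "a ⊗ b" := (tob T a b) (at level 39, left associativity).
Local Notation "f ⊠ g" := (thom T f g) (at level 39, left associativity).
Local Notation I := (tunit T).
Variables (α : associator_family T) (n : nat) (irr : 'I_n.+1 -> Ob C).

Lemma Smx_unit ε : Smx α ε irr \in unitmx ->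
  gauss_sum α ε irr != 0 /\ Ymx α ε irr \in unitmx.
Proof.
rewrite /Smx => u; have s0 : gauss_sum α ε irr != 0.
  by apply: contraTneq u => ->; rewrite normr0 invr0 scale0r unitmxE det0 unitr0.
split=> //; move: u; rewrite unitmxZ // unitfE invr_eq0 normr_eq0 //.
Qed.

(** The equality of the entries for the unit label removes the cube roots. *)
Lemma Tmx_twist ε ε' : gauss_sum α ε irr != 0 ->
    twist α ε (irr ord0) = 1 -> twist α ε' (irr ord0) = 1 ->
    Tmx α ε irr = Tmx α ε' irr ->
  forall i, twist α ε (irr i) = twist α ε' (irr i).
Proof.
move=> s0 w0 w0' /matrixP h.
have hd i : 3.-root (gauss_sum α ε irr / `|gauss_sum α ε irr|) * twist α ε (irr i)
    = 3.-root (gauss_sum α ε' irr / `|gauss_sum α ε' irr|) * twist α ε' (irr i).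
  by have := h i i; rewrite !mxE eqxx !mulr1.
move=> i; have e := hd ord0; rewrite w0 w0' !mulr1 in e.
have := hd i; rewrite -e => /mulfI; apply.
by rewrite rootC_eq0 // mulf_neq0 // invr_eq0 normr_eq0.
Qed.

(** On a representative of the unit class any two braidings agree. *)
Lemma braid_unit_agree ε ε' a c : unitary_associator α ->
  unitary_braiding α ε -> unitary_braiding α ε' -> unitarily_iso a I ->
  ε a c = ε' a c.
Proof.
move=> Hα Hε Hε' [u uu].
apply: (unitary_lcan (thom_unitary T (unitary1 c) uu)).
rewrite -(braid_natural Hε) -(braid_natural Hε').
by rewrite !(braid_unitl Hα).
Qed.

End Data.

Section Components.
Context {R : realType} {C : cstar_category R} {T : tensor_data C}.
Local Notation "a ⊗ b" := (tob T a b) (at level 39, left associativity).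
Local Notation I := (tunit T).
Variables (α : associator_family T) (n : nat) (irr : 'I_n.+1 -> Ob C).
Variables (ε ε' : braiding_family T).
Hypotheses (Hε : unitary_braiding α ε) (Hε' : unitary_braiding α ε').
Hypothesis dbl : forall i j, ε (irr j) (irr i) ∘ ε (irr i) (irr j)
  = ε' (irr j) (irr i) ∘ ε' (irr i) (irr j).
Hypothesis self : forall i, exists2 u : Mor (irr i ⊗ irr i) (irr i ⊗ irr i),
  unitary u & u ∘ ε' (irr i) (irr i) = ε (irr i) (irr i) ∘ u.
Hypothesis unit0 : forall c, ε (irr ord0) c = ε' (irr ord0) c.

(** Unitaries intertwining the braidings of irreducibles. For [i < j] the
    component at [(i, j)] is trivial and the one at [(j, i)] is forced; this is
    consistent because the double braidings agree. *)
Lemma intertwiner_components :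
  exists u : forall i j, Mor (irr i ⊗ irr j) (irr i ⊗ irr j),
  [/\ forall i j, unitary (u i j),
      forall i j, u j i ∘ ε' (irr i) (irr j) = ε (irr i) (irr j) ∘ u i j,
      forall j, u ord0 j = 1_(_)
    & forall i, u i ord0 = 1_(_)].
Proof.
have HV i : exists v : Mor (irr i ⊗ irr i) (irr i ⊗ irr i),
    [/\ unitary v, v ∘ ε' (irr i) (irr i) = ε (irr i) (irr i) ∘ v
      & i = ord0 -> v = 1_(_)].
  have [->|i0] := pselect (i = ord0).
    by exists (1_(_)); split=> //; [apply: unitary1|rewrite unit0 comp1m compm1].
  by have [v v1 v2] := self i; exists v.
pose v i := sval (cid (HV i)).
have hv i : [/\ unitary (v i), v i ∘ ε' (irr i) (irr i) = ε (irr i) (irr i) ∘ v i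
      & i = ord0 -> v i = 1_(_)] by exact: svalP (cid (HV i)).
pose u i j : Mor (irr i ⊗ irr j) (irr i ⊗ irr j) :=
  match i =P j with
  | ReflectT e => ecast k (Mor (irr i ⊗ irr k) (irr i ⊗ irr k)) e (v i)
  | ReflectF _ => if (i < j)%N then 1_(_)
      else ε (irr j) (irr i) ∘ (ε' (irr j) (irr i))^†
  end.
have uii i : u i i = v i by rewrite /u; case: eqP => // e; rewrite (eq_axiomK e).
have ult (i j : 'I_n.+1) : (i < j)%N -> u i j = 1_(_).
  by move=> h; rewrite /u h; case: eqP => // e; exfalso; rewrite e ltnn in h.
have ugt (i j : 'I_n.+1) : (j < i)%N ->
    u i j = ε (irr j) (irr i) ∘ (ε' (irr j) (irr i))^†.
  move=> h; rewrite /u ltnNge (ltnW h) /=; case: eqP => // e.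
  by exfalso; rewrite e ltnn in h.
have cmp (i j : 'I_n.+1) : [\/ i = j, (i < j)%N | (j < i)%N].
  case: (ltngtP i j) => h; [exact: Or32|exact: Or33|].
  by apply: Or31; apply: val_inj.
exists u; split.
- move=> i j; case: (cmp i j) => [<-|/ult ->|/ugt ->].
  + by rewrite uii; case: (hv i).
  + exact: unitary1.
  + by apply: unitaryM; [|apply: unitaryV]; apply: braid_unitary; eassumption.
- move=> i j; case: (cmp i j) => [<-|h|h].
  + by rewrite uii; case: (hv i).
  + rewrite (ult _ _ h) (ugt _ _ h) compm1 -compmA.
    by have [-> _] := braid_unitary Hε' (irr i) (irr j); rewrite compm1.
  + rewrite (ult _ _ h) (ugt _ _ h) comp1m compmA dbl -compmA.
    by have [_ ->] := braid_unitary Hε' (irr j) (irr i); rewrite compm1.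
- move=> j; case: (cmp ord0 j) => [<-|/ult //|//].
  by rewrite uii; case: (hv ord0) => _ _ ->.
- move=> i; case: (cmp i ord0) => [->|//|/ugt ->].
    by rewrite uii; case: (hv ord0) => _ _ ->.
  by rewrite unit0; case: (braid_unitary Hε' (irr ord0) (irr i)).
Qed.

End Components.

Theorem proposition3p4 (R : realType) (C : cstar_category R) (T : tensor_data C)
    (α0 : associator_family T) (ε ε' : braiding_family T)
    (Hstrict : strict α0)
    (HC1 : umtc α0 ε) (HC2 : umtc α0 ε')
    (n : nat) (irr : 'I_n.+1 -> Ob C) (Hirr : spectrum T irr)
    (Hdata : modular_data_of α0 ε irr = modular_data_of α0 ε' irr) :
  exists (α : associator_family T) (U : tensor_endo_family T),
    unitary_fusion α /\
    unitary_tensor_equivalence α0 α U /\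
    unitary_braiding α ε' /\
    braided U ε ε'.
Proof.
have Hf := umtc_fusion HC1; have Hα := fusion_associator Hf.
have Hε := umtc_braiding HC1; have Hε' := umtc_braiding HC2.
have [irrI irrN irrE irr0] := Hirr.
have sub := fusion_subobjects Hf.
(* duals of the irreducibles, with their dimensions and twists *)
have H i := irreducible_dual Hα (fusion_unit Hf) (irrI i) (fusion_conjugates Hf).
pose cj i := sval (cid (H i)).
pose D i : dual (L Hα (irr i)) (L Hα (cj i)) := sval (cid (svalP (cid (H i)))).
have HD i := svalP (cid (svalP (cid (H i)))).
have d1 i x : ptr (D i) (1_(L Hα (irr i) x)) = qdim α0 (irr i) *: 1_x.
  by case: (HD i) => _ h _ _ _; apply: h.
have d0 i : 0 < qdim α0 (irr i) by case: (HD i).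
have dw i ε0 x : ptr (D i) (bx Hα ε0 (irr i) (irr i) x)
    = twist α0 ε0 (irr i) *: 1_(L Hα (irr i) x).
  by case: (HD i) => _ _ h _ _; apply: h.
have ds i φ : iscell (L Hα (cj i)) (L Hα (cj i)) φ ->
    exists z, forall x, φ x = z *: 1_(L Hα (cj i) x).
  by case: (HD i) => _ _ _ h _; apply: h.
have du i : exists s : Mor (tunit T) (tob T (irr i) (cj i)), s <> 0 by case: (HD i).
(* the modular data determine the twists, and these the braidings up to
   conjugation by unitaries on pairs of irreducibles *)
have [s0 Yu] := Smx_unit (umtc_modular HC1 Hirr).
have tw := Tmx_twist s0 (twist_ord0 Hf Hirr d0 d1 dw Hε)
  (twist_ord0 Hf Hirr d0 d1 dw Hε') (congr1 (@md_T _ _) Hdata).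
have [u [u1 u2 u3 u4]] := intertwiner_components Hε Hε'
  (double_braiding_agree Hf Hirr d0 d1 dw ds du Hε Hε' tw)
  (self_braiding_conjugate Hf Hirr d0 d1 dw ds du Hε Hε' tw Yu)
  (fun c => braid_unit_agree c Hα Hε Hε' irr0).
(* extend these unitaries to all objects *)
have E a := exists_decomposition irrI irrN irrE sub a.
pose m a := sval (cid (E a)).
pose e a : forall k, 'I_(m a k) -> Mor (irr k) a := sval (cid (svalP (cid (E a)))).
have de a : decomposition (e a) by exact: (svalP (cid (svalP (cid (E a))))).
pose U := extend e u.
have UE := extend_irr irrI irrN de u.
have Uu := extend_unitary irrI irrN irrE sub de u1.
have Un := extend_natural irrI irrN irrE sub de u.
have [u0 [u01 u02]] := irr0.
have v0 i (f : Mor (irr i) (tunit T)) : i <> ord0 -> f = 0.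
  move=> i0; rewrite -[f]comp1m -u02 -compmA.
  by rewrite (irr_hom0 irrI irrN (u0^† ∘ f)) // compm0.
have Ul b : U (tunit T) b = 1_(_).
  apply: (pair_separate irrI irrN irrE sub) => i j f g; rewrite UE comp1m.
  have [i0|i0] := pselect (i = ord0); last by rewrite (v0 _ f i0) thom0l comp0m.
  by subst i; rewrite u3 compm1.
have Ur a : U a (tunit T) = 1_(_).
  apply: (pair_separate irrI irrN irrE sub) => i j f g; rewrite UE comp1m.
  have [j0|j0] := pselect (j = ord0); last by rewrite (v0 _ g j0) thom0r comp0m.
  by subst j; rewrite u4 compm1.
have Ub : braided U ε ε'.
  move=> a b; apply: (pair_separate irrI irrN irrE sub) => i j f g.
  rewrite -compmA (braid_natural Hε') compmA UE -compmA u2 -[RHS]compmA UE.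
  by rewrite !compmA (braid_natural Hε).
exists (transport_associator α0 U), U; split; [|split; [|split]] => //.
- split; try by case: Hf.
    exact: transport_unitary_associator.
  by apply: transport_has_conjugates => //; case: Hf.
- exact: transport_equivalence.
- exact: (transport_braiding Uu Un Hε Ub).
Qed.
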